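(* Let $k$ be a field. (a) Let $(\mathcal{C},\cdot,1)$ be a strict monoidal category whose underlying category $\mathcal{C}$ is Möbius, and suppose the monoidal product functor $\cdot:\mathcal{C}\times\mathcal{C}\to\mathcal{C}$ has the unique lifting of factorisations (ULF) property. Then the $k$-linear extension of $\cdot$ to $k\mathcal{C}$, with unit $i_1$, turns the incidence coalgebra $(k\mathcal{C},\Delta,\varepsilon)$ (with scaling $\lambda=1$) into a pointed bialgebra. If moreover the monoid $(\mathrm{Ob}\,\mathcal{C},\cdot,1)$ of objects is a group, then this bialgebra is a Hopf algebra. (b) Suppose $k$ has characteristic zero and let $(\mathcal{C},\cdot,1)$ be a locally finite strict 2-group. Let $S=\bigcup_{x\in \mathrm{Ob}\,\mathcal{C}}\mathcal{C}(1,x)$ be the (finite) set of morphisms with source $1$. Then the $k$-linear extension of $\cdot$ to $k\mathcal{C}$, with unit $i_1$, turns the scaled incidence coalgebra $(k\mathcal{C},\Delta,\varepsilon)$ with scaling $\lambda=|S|$ into a weak Hopf algebra (i.e. there is an antipode making it a weak Hopf algebra).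
   Context: All categories are small, all monoidal categories are strict. $\mathcal{C}$ denotes both a category and its set of morphisms; $\mathcal{C}(x,y)$ is the set of morphisms $x\to y$; $i_x$ is the identity of the object $x$; $\mathrm{Id}\,\mathcal{C}$ is the set of identity morphisms. For $f\in\mathcal{C}$ and $n\in\mathbb{N}$ let $N_n(f)=\{(a_1,\dots,a_n)\in\mathcal{C}^{\times n}\mid a_1\circ\cdots\circ a_n=f\}$, let $\hat N_n(f)\subseteq N_n(f)$ be the subset of those tuples in which no $a_i$ is an identity morphism, and $\hat N(f)=\bigcup_n \hat N_n(f)$. $\mathcal{C}$ is locally finite if $N_2(f)$ is finite for all $f\in\mathcal{C}$, and Möbius if $\hat N(f)$ is finite for all $f\in\mathcal{C}$. (Möbius categories are locally finite.) A functor $F:\mathcal{C}\to\mathcal{D}$ has the ULF property if for all $f\in\mathcal{C}$ the map $N_2(f)\to N_2(Ff)$, $(a,b)\mapsto(Fa,Fb)$, is a bijection. For $\mathcal{C}$ locally finite and $0\neq\lambda\in k$, the scaled incidence coalgebra is the free $k$-module $k\mathcal{C}$ on the set of morphisms of $\mathcal{C}$ with $$\Delta(f)=\frac1\lambda\sum_{(a,b)\in N_2(f)}a\otimes b,\qquad \varepsilon(f)=\lambda\text{ if }f\in\mathrm{Id}\,\mathcal{C},\quad \varepsilon(f)=0\text{ otherwise}.$$ The incidence coalgebra is the case $\lambda=1$. A strict 2-group is a strict monoidal category which is a groupoid and in which every object $x$ is invertible: there is an object $y$ with $x\cdot y=1=y\cdot x$. A weak Hopf algebra over $k$ is $(A,\mu,1,\Delta,\varepsilon,\sigma)$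 such that $(A,\mu,1)$ is an associative unital algebra, $(A,\Delta,\varepsilon)$ is a coassociative counital coalgebra, $\Delta(ab)=\Delta(a)\Delta(b)$, $\varepsilon(ab)=\varepsilon(a1_{(1)})\varepsilon(1_{(2)}b)=\varepsilon(a1_{(2)})\varepsilon(1_{(1)}b)$, $(\Delta(1)\otimes1)(1\otimes\Delta(1))=\Delta^2(1)=(1\otimes\Delta(1))(\Delta(1)\otimes1)$ where $\Delta^2=(\Delta\otimes\mathrm{id})\Delta$, and $\sigma:A\to A$ is a $k$-linear map (the antipode) with $\sigma(a)=\sigma(a_{(1)})a_{(2)}\sigma(a_{(3)})$, $\sigma(a_{(1)})a_{(2)}=1_{(1)}\varepsilon(a1_{(2)})$, $a_{(1)}\sigma(a_{(2)})=\varepsilon(1_{(1)}a)1_{(2)}$. *)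

(* Defs.v *)
From HB Require Import structures.
From mathcomp Require Import all_boot all_order all_algebra finmap.
From mathcomp Require Import boolp classical_sets functions cardinality fsbigop.
From mathcomp Require Import monalg.

Set Implicit Arguments.
Unset Strict Implicit.
Unset Printing Implicit Defensive.

Import GRing.Theory.

Local Open Scope classical_set_scope.
Local Open Scope ring_scope.

(* Small categories, presented by their set of morphisms.  [comp f g] is f o g;
   it is a total function, but only its values at composable pairs
   ([src f = tgt g]) matter: no axiom or definition below constrains or uses
   the others. *)
Record category := Category {
  obj : Type;
  mor :> choiceType;
  src : mor -> obj;
  tgt : mor -> obj;
  idm : obj -> mor;
  comp : mor -> mor -> mor;
  src_idm : forall x, src (idm x) = x;
  tgt_idm : forall x, tgt (idm x) = x;
  src_comp : forall f g, src f = tgt g -> src (comp f g) = src g;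
  tgt_comp : forall f g, src f = tgt g -> tgt (comp f g) = tgt f;
  compA : forall f g h, src f = tgt g -> src g = tgt h ->
    comp f (comp g h) = comp (comp f g) h;
  compm1 : forall f, comp f (idm (src f)) = f;
  comp1m : forall f, comp (idm (tgt f)) f = f
}.

Definition hom (C : category) (x y : obj C) : set C :=
  [set f | src f = x /\ tgt f = y].

Definition Id (C : category) : set C := range (@idm C).
Arguments Id C : clear implicits.

Section ProductCategory.
Variables C D : category.

Let M : choiceType := (C * D)%type.
Let srcp (f : M) := (src f.1, src f.2).
Let tgtp (f : M) := (tgt f.1, tgt f.2).
Let idp (x : obj C * obj D) : M := (idm x.1, idm x.2).
Let compp (f g : M) : M := (comp f.1 g.1, comp f.2 g.2).

Fact src_idp x : srcp (idp x) = x.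
Proof. by case: x => x y; rewrite /srcp /= !src_idm. Qed.

Fact tgt_idp x : tgtp (idp x) = x.
Proof. by case: x => x y; rewrite /tgtp /= !tgt_idm. Qed.

Fact src_compp f g : srcp f = tgtp g -> srcp (compp f g) = srcp g.
Proof. by case=> e1 e2; rewrite /srcp /= !src_comp. Qed.

Fact tgt_compp f g : srcp f = tgtp g -> tgtp (compp f g) = tgtp f.
Proof. by case=> e1 e2; rewrite /tgtp /= !tgt_comp. Qed.

Fact comppA f g h : srcp f = tgtp g -> srcp g = tgtp h ->
  compp f (compp g h) = compp (compp f g) h.
Proof. by case=> e1 e2 [e3 e4]; rewrite /compp /= !compA. Qed.

Fact comppm1 f : compp f (idp (srcp f)) = f.
Proof. by case: f => f g; rewrite /compp /= !compm1. Qed.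

Fact compp1m f : compp (idp (tgtp f)) f = f.
Proof. by case: f => f g; rewrite /compp /= !comp1m. Qed.

Definition prod_cat : category :=
  Category src_idp tgt_idp src_compp tgt_compp comppA comppm1 compp1m.

End ProductCategory.

Record functor (C D : category) := Functor {
  fobj : obj C -> obj D;
  fmor :> C -> D;
  src_fmor : forall f, src (fmor f) = fobj (src f);
  tgt_fmor : forall f, tgt (fmor f) = fobj (tgt f);
  fmor_idm : forall x, fmor (idm x) = idm (fobj x);
  fmor_comp : forall f g, src f = tgt g ->
    fmor (comp f g) = comp (fmor f) (fmor g)
}.

Section Factorisations.
Variable C : category.

(* [composes_to f s]: the entries of s are composable and their composite, from
   left to right, is f.  The composites of the empty sequence are the identity
   morphisms. *)
Fixpoint composes_to (f : C) (s : seq C) : Prop :=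
  if s is a :: s' then
    exists g, [/\ composes_to g s', src a = tgt g & comp a g = f]
  else f \in Id C.

Definition N n (f : C) : set (n.-tuple (mor C)) := [set s | composes_to f s].
Arguments N n f : clear implicits.

Definition hatN_ n (f : C) : set (n.-tuple (mor C)) :=
  N n f `&` [set s | forall i, ~ Id C (tnth s i)].
Arguments hatN_ n f : clear implicits.

(* The tuples of the various lengths are collected as sequences. *)
Definition hatN (f : C) : set (seq C) :=
  \bigcup_n [set (s : seq C) | s in hatN_ n f].

(* [N 2 f] with pairs instead of 2-tuples, see [N2E]. *)
Definition N2 (f : C) : set (C * C) :=
  [set p | src p.1 = tgt p.2 /\ comp p.1 p.2 = f].

Lemma N2E f a b : N2 f (a, b) <-> N 2 f [tuple a; b].
Proof.
split=> [[/= e <-]|/= [g [[h [/set_mem [x _ <-] sb <-]] sa <-]]].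
  exists b; split=> //; exists (idm (src b)).
  split; rewrite ?tgt_idm ?compm1 //.
  by apply/mem_set; exists (src b).
move: sb sa; rewrite tgt_idm => <-; rewrite compm1 => sa.
by [].
Qed.

Definition locally_finite := forall f, finite_set (N2 f).

Definition moebius := forall f, finite_set (hatN f).

Definition groupoid :=
  forall f : C, exists g : C,
    [/\ src g = tgt f, tgt g = src f,
        comp g f = idm (src f) & comp f g = idm (tgt f)].

End Factorisations.
Arguments N {C} n f.
Arguments hatN_ {C} n f.

Definition ULF (C D : category) (F : functor C D) :=
  forall f, set_bij (N2 f) (N2 (F f)) (fun p => (F p.1, F p.2)).

Record monoidal_cat := MonoidalCat {
  mcat :> category;
  mprod : functor (prod_cat mcat mcat) mcat;
  munit : obj mcat;
  mprod_objA : forall x y z : obj mcat,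
    fobj mprod (x, fobj mprod (y, z)) = fobj mprod (fobj mprod (x, y), z);
  mprod_obj1x : forall x, fobj mprod (munit, x) = x;
  mprod_objx1 : forall x, fobj mprod (x, munit) = x;
  mprod_morA : forall f g h : mcat,
    mprod (f, mprod (g, h)) = mprod (mprod (f, g), h);
  mprod_mor1x : forall f, mprod (idm munit, f) = f;
  mprod_morx1 : forall f, mprod (f, idm munit) = f
}.

Definition obj_group (C : monoidal_cat) :=
  forall x : obj C, exists y,
    fobj (mprod C) (x, y) = munit C /\ fobj (mprod C) (y, x) = munit C.

Definition strict_2group (C : monoidal_cat) := groupoid C /\ obj_group C.

(* Coalgebras need tensor products of k-modules, which are used here for free
   modules only: k[B] (x) k[B'] is realised as k[B * B'].  Lemmas [tliftT],
   [tlift_linear] and [tensor_ext] are the universal property of the tensor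
   product. *)
Section Tensor.
Variable k : fieldType.

Definition lext (B : choiceType) (W : lmodType k) (f : B -> W)
  (a : {malg k[B]}) : W := \sum_(x <- msupp a) a@_x *: f x.

Definition tensor (B B' : choiceType) (a : {malg k[B]}) (b : {malg k[B']}) :
    {malg k[(B * B')%type]} :=
  lext (fun x => lext (fun y => << (x, y) >>) b) a.

(* The linear map a (x) b |-> F a b induced by a bilinear F: if t is written
   t_(1) (x) t_(2) in Sweedler notation, [tlift F t] is F t_(1) t_(2). *)
Definition tlift (B B' : choiceType) (W : lmodType k)
    (F : {malg k[B]} -> {malg k[B']} -> W) :
    {malg k[(B * B')%type]} -> W :=
  lext (fun p => F << p.1 >> << p.2 >>).

Lemma lextw (B : choiceType) (W : lmodType k) (f : B -> W)
    (a : {malg k[B]}) (d : {fset B}) :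
  (msupp a `<=` d)%fset -> lext f a = \sum_(x <- d) a@_x *: f x.
Proof.
move=> sad; rewrite /lext; apply: big_fset_incl => // x _ xa.
by rewrite mcoeff_outdom // scale0r.
Qed.

Lemma lext_linear (B : choiceType) (W : lmodType k) (f : B -> W) :
  linear (lext f).
Proof.
move=> c a b; pose d := (msupp (c *: a + b) `|` (msupp a `|` msupp b))%fset.
rewrite (@lextw _ _ f (c *: a + b) d) ?fsubsetUl //.
rewrite (@lextw _ _ f a d); last by rewrite /d fsetUCA fsubsetUl.
rewrite (@lextw _ _ f b d); last by rewrite /d fsetUA fsubsetUr.
rewrite scaler_sumr -big_split /=; apply: eq_bigr => x _.
by rewrite mcoeffD mcoeffZ scalerDl scalerA.
Qed.

Lemma lextU (B : choiceType) (W : lmodType k) (f : B -> W) x :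
  lext f << x >> = f x.
Proof.
rewrite (lextw _ (msuppU_le)) big_seq_fset1 mcoeffUU scale1r.
by [].
Qed.

Lemma lext_ext (B : choiceType) (W : lmodType k) (f g : {malg k[B]} -> W) :
  linear f -> linear g -> (forall x, f << x >> = g << x >>) -> f =1 g.
Proof.
move=> lf lg fg a.
have sumL (h : {malg k[B]} -> W) : linear h -> h a = lext (h \o mkmalgU^~ 1) a.
  move=> lh; pose H := GRing.isLinear.Build k _ _ _ h lh.
  pose L : {linear {malg k[B]} -> W} := HB.pack h H.
  rewrite -[LHS]/(L a) {1}[a]monalgE raddf_sum /lext /=.
  apply: eq_bigr => x _; have -> : << a@_x *g x >> = a@_x *: << x >>.
    by apply/malgP => y; rewrite mcoeffZ !mcoeffU mulrnAr mulr1.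
  by rewrite -[LHS]/(L _) linearZ.
by rewrite (sumL f) // (sumL g) // /lext; apply: eq_bigr => x _ /=; rewrite fg.
Qed.

Lemma tensor_linearl (B B' : choiceType) (b : {malg k[B']}) :
  linear (fun a : {malg k[B]} => tensor a b).
Proof. exact: lext_linear. Qed.

Lemma tensor_linearr (B B' : choiceType) (a : {malg k[B]}) :
  linear (fun b : {malg k[B']} => tensor a b).
Proof.
move=> c b b'; rewrite /tensor /lext scaler_sumr -big_split /=.
apply: eq_bigr => x _; rewrite -!/(lext _ _) lext_linear scalerDr.
by rewrite !scalerA mulrC.
Qed.

Lemma tensorU (B B' : choiceType) (x : B) (y : B') :
  tensor << x >> << y >> = << (x, y) >> :> {malg k[(B * B')%type]}.
Proof. by rewrite /tensor !lextU. Qed.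

Lemma tlift_linear (B B' : choiceType) (W : lmodType k)
  (F : {malg k[B]} -> {malg k[B']} -> W) : linear (tlift F).
Proof. exact: lext_linear. Qed.

Lemma tliftT (B B' : choiceType) (W : lmodType k)
    (F : {malg k[B]} -> {malg k[B']} -> W) :
    (forall b, linear (F^~ b)) -> (forall a, linear (F a)) ->
  forall a b, tlift F (tensor a b) = F a b.
Proof.
move=> Fl Fr a b; move: a.
apply: (@lext_ext _ _ (fun a => tlift F (tensor a b)) (F^~ b)) => // [c a a'|x].
  by rewrite tensor_linearl tlift_linear.
move: b; apply: (@lext_ext _ _ (fun b => tlift F (tensor << x >> b))) => //.
  by move=> c b b'; rewrite tensor_linearr tlift_linear.
by move=> y; rewrite tensorU /tlift lextU.
Qed.

Lemma tensor_ext (B B' : choiceType) (W : lmodType k)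
    (f g : {malg k[(B * B')%type]} -> W) :
    linear f -> linear g ->
    (forall a b, f (tensor a b) = g (tensor a b)) -> f =1 g.
Proof.
move=> lf lg fg; apply: lext_ext => // -[x y].
by rewrite -tensorU fg.
Qed.

Definition tmap (B1 B1' B2 B2' : choiceType)
    (f : {malg k[B1]} -> {malg k[B2]}) (g : {malg k[B1']} -> {malg k[B2']}) :
    {malg k[(B1 * B1')%type]} -> {malg k[(B2 * B2')%type]} :=
  tlift (fun a b => tensor (f a) (g b)).

Definition tassoc (B1 B2 B3 : choiceType) :
    {malg k[(B1 * (B2 * B3))%type]} -> {malg k[(B1 * B2 * B3)%type]} :=
  tlift (fun a => tlift (fun b c => tensor (tensor a b) c)).

(* (a (x) a') (b (x) b') = a b (x) a' b' *)
Definition tmul (B B' : choiceType)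
    (m : {malg k[B]} -> {malg k[B]} -> {malg k[B]})
    (m' : {malg k[B']} -> {malg k[B']} -> {malg k[B']})
    (s t : {malg k[(B * B')%type]}) : {malg k[(B * B')%type]} :=
  tlift (fun a a' => tlift (fun b b' => tensor (m a b) (m' a' b')) t) s.

End Tensor.

Section Structures.
Variables (k : fieldType) (B : choiceType).
Local Notation A := {malg k[B]}.
Local Notation A2 := {malg k[(B * B)%type]}.
Local Notation A3 := {malg k[(B * B * B)%type]}.

Implicit Types (mul : A -> A -> A) (one : A) (Delta : A -> A2) (eps : A -> k)
  (sigma : A -> A).

Record is_algebra mul one : Prop := IsAlgebra {
  alg_linearl : forall b, linear (mul^~ b);
  alg_linearr : forall a, linear (mul a);
  alg_assoc : forall a b c, mul a (mul b c) = mul (mul a b) c;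
  alg_unitl : forall a, mul one a = a;
  alg_unitr : forall a, mul a one = a
}.

(* Delta^2 = (Delta (x) id) Delta *)
Definition Delta2 Delta (a : A) : A3 := tmap Delta id (Delta a).

Record is_coalgebra Delta eps : Prop := IsCoalgebra {
  coalg_linear : linear Delta;
  coalg_scalar : scalar eps;
  coalg_coassoc : forall a,
    Delta2 Delta a = tassoc (tmap id Delta (Delta a));
  coalg_counitl : forall a, tlift (fun a1 a2 => eps a1 *: a2) (Delta a) = a;
  coalg_counitr : forall a, tlift (fun a1 a2 => eps a2 *: a1) (Delta a) = a
}.

Record is_bialgebra mul one Delta eps : Prop := IsBialgebra {
  bialg_algebra : is_algebra mul one;
  bialg_coalgebra : is_coalgebra Delta eps;
  bialg_DeltaM : forall a b,
    Delta (mul a b) = tmul mul mul (Delta a) (Delta b);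
  bialg_Delta1 : Delta one = tensor one one;
  bialg_epsM : forall a b, eps (mul a b) = eps a * eps b;
  bialg_eps1 : eps one = 1
}.

Record is_Hopf mul one Delta eps sigma : Prop := IsHopf {
  Hopf_bialgebra : is_bialgebra mul one Delta eps;
  Hopf_linear : linear sigma;
  Hopf_antipodel : forall a,
    tlift (fun a1 a2 => mul (sigma a1) a2) (Delta a) = eps a *: one;
  Hopf_antipoder : forall a,
    tlift (fun a1 a2 => mul a1 (sigma a2)) (Delta a) = eps a *: one
}.

Record is_weak_Hopf mul one Delta eps sigma : Prop := IsWeakHopf {
  wHopf_algebra : is_algebra mul one;
  wHopf_coalgebra : is_coalgebra Delta eps;
  wHopf_DeltaM : forall a b,
    Delta (mul a b) = tmul mul mul (Delta a) (Delta b);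
  wHopf_epsM12 : forall a b,
    eps (mul a b) =
    tlift (W := k^o) (fun u v => eps (mul a u) * eps (mul v b)) (Delta one);
  wHopf_epsM21 : forall a b,
    eps (mul a b) =
    tlift (W := k^o) (fun u v => eps (mul a v) * eps (mul u b)) (Delta one);
  wHopf_Delta1l :
    tmul (tmul mul mul) mul
      (tensor (Delta one) one) (tassoc (tensor one (Delta one)))
    = Delta2 Delta one;
  wHopf_Delta1r :
    tmul (tmul mul mul) mul
      (tassoc (tensor one (Delta one))) (tensor (Delta one) one)
    = Delta2 Delta one;
  wHopf_linear : linear sigma;
  wHopf_antipode : forall a,
    sigma a = tlift (fun t a3 =>
      tlift (fun a1 a2 => mul (mul (sigma a1) a2) (sigma a3)) t)
      (Delta2 Delta a);
  wHopf_antipodel : forall a,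
    tlift (fun a1 a2 => mul (sigma a1) a2) (Delta a) =
    tlift (fun u v => eps (mul a v) *: u) (Delta one);
  wHopf_antipoder : forall a,
    tlift (fun a1 a2 => mul a1 (sigma a2)) (Delta a) =
    tlift (fun u v => eps (mul u a) *: v) (Delta one)
}.

Definition is_subspace (D : set A) :=
  D 0 /\ forall c a b, D a -> D b -> D (c *: a + b).

(* The subspace D (x) D of A (x) A. *)
Definition tensor_square (D : set A) : set A2 :=
  [set t | exists s : seq (A * A),
    (forall p, p \in s -> D p.1 /\ D p.2) /\
    t = \sum_(p <- s) tensor p.1 p.2].

Definition is_subcoalgebra Delta (D : set A) :=
  is_subspace D /\ forall a, D a -> tensor_square D (Delta a).

Definition is_simple_subcoalgebra Delta (D : set A) :=
  [/\ is_subcoalgebra Delta D, D <> [set 0] &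
      forall E, is_subcoalgebra Delta E -> E `<=` D -> E = [set 0] \/ E = D].

Definition is_pointed Delta :=
  forall D, is_simple_subcoalgebra Delta D ->
    exists2 d, d <> 0 & D = range (fun c : k => c *: d).

End Structures.

Section Incidence.
Variables (k : fieldType) (C : category) (lambda : k).

Definition inc_Delta : {malg k[C]} -> {malg k[(C * C)%type]} :=
  lext (fun f =>
    lambda^-1 *: \sum_(p \in N2 f) (<< p >> : {malg k[(C * C)%type]})).

Definition inc_eps : {malg k[C]} -> k :=
  lext (W := k^o) (fun f => if f \in Id C then lambda else 0).

End Incidence.
Arguments inc_Delta k C lambda _ : clear implicits.
Arguments inc_eps k C lambda _ : clear implicits.

Section IncidenceMonoidal.
Variables (k : fieldType) (C : monoidal_cat).

Definition inc_mul (a b : {malg k[C]}) : {malg k[C]} :=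
  lext (fun f => lext (fun g => << mprod C (f, g) >>) b) a.

Definition inc_one : {malg k[C]} := << idm (munit C) >>.

End IncidenceMonoidal.
Arguments inc_mul k C _ _ : clear implicits.
Arguments inc_one k C : clear implicits.

Definition mor_from_unit (C : monoidal_cat) : set C :=
  \bigcup_x hom (munit C) x.
Arguments mor_from_unit C : clear implicits.

(* Main.v *)
(* A bialgebra on the incidence coalgebra comes down to identities between sums
   over factorisations p of a morphism f, f = p.1 o p.2.

   (a) ULF says that the factorisations of f . g are the products of those of f
   and g.  Let len f be the maximal length of a factorisation of f into
   non-identities; in a nontrivial factorisation, both factors are shorter.
   If f is of maximal length in the support of an element a of a subcoalgebra,
   the only term of Delta a with first factor f is a@_f f (x) id, hence every
   nonzero subcoalgebra contains an identity morphism.  By recursion on the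
   length, a map C -> kC has a convolution inverse as soon as its values at
   identities are invertible.

   (b) In a 2-group, writing x' for the inverse of the object x, the composite
   f o g is f . i_{x'} . g with x = src f, and the antipode is
   f |-> i_{y'} . f . i_{x'} for f : x -> y.  Every f has lambda = |S|
   factorisations, and every factorisation of f . g is the product of exactly
   lambda pairs of factorisations of f and g: this is what the scaling
   compensates. *)

Require Import Defs.
From mathcomp Require Import all_boot all_order all_algebra finmap.
From mathcomp Require Import boolp classical_sets functions cardinality fsbigop.
From mathcomp Require Import monalg.

Import GRing.Theory.

Local Open Scope ring_scope.

Set Implicit Arguments.
Unset Strict Implicit.
Unset Printing Implicit Defensive.

(* The libraries above shadow comp and functor. *)
Import Defs.
Local Open Scope classical_set_scope.

(** * Reindexing of sums over finite sets *)

Lemma set_bij_can (I J : Type) (P : set I) (Q : set J) (h : I -> J)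
    (h' : J -> I) :
    (forall x, P x -> Q (h x)) -> (forall y, Q y -> P (h' y)) ->
    (forall x, P x -> h' (h x) = x) -> (forall y, Q y -> h (h' y) = y) ->
  set_bij P Q h.
Proof.
move=> PQ QP hK h'K; split=> //.
  by move=> x y /set_mem Px /set_mem Py /(congr1 h'); rewrite !hK.
by move=> y Qy; exists (h' y); [exact: QP|exact: h'K].
Qed.

Lemma fsum_can (W : zmodType) (I J : choiceType) (P : set I) (Q : set J)
    (h : I -> J) (h' : J -> I) (F : J -> W) :
    (forall x, P x -> Q (h x)) -> (forall y, Q y -> P (h' y)) ->
    (forall x, P x -> h' (h x) = x) -> (forall y, Q y -> h (h' y) = y) ->
  \sum_(y \in Q) F y = \sum_(x \in P) F (h x).
Proof.
by move=> PQ QP hK h'K; exact/reindex_fsbig/(set_bij_can PQ QP hK h'K).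
Qed.

(** The inner index sets vary with [i]; extending the inner sums by zero to the union [R] of all
    [Q i] reduces this to a sum over a product of sets. *)
Lemma pair_fsbig_dep (W : zmodType) (I J : choiceType) (P : set I)
    (Q : I -> set J) (F : I -> J -> W) :
    finite_set P -> (forall i, finite_set (Q i)) ->
  \sum_(i \in P) \sum_(j \in Q i) F i j =
  \sum_(x \in [set x | P x.1 /\ Q x.1 x.2]) F x.1 x.2.
Proof.
move=> Pfin Qfin; pose R := \bigcup_(i in P) Q i.
have Rfin : finite_set R by exact: bigcup_finite.
transitivity (\sum_(i \in P) \sum_(j \in R) (if j \in Q i then F i j else 0)).
  apply: eq_fsbigr => i /set_mem Pi; rewrite -fsbig_mkcondr; apply: eq_fsbigl.
  by rewrite setIC; apply/esym/setIidl => j Qj; exists i.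
rewrite pair_fsbig//.
transitivity (\sum_(x \in P `*` R)
    (if x \in [set x | Q x.1 x.2] then F x.1 x.2 else 0)).
  by apply: eq_fsbigr => x _; congr (if _ then _ else _);
    apply/idP/idP => /set_mem ?; exact/mem_set.
rewrite -fsbig_mkcondr; apply: eq_fsbigl; apply/seteqP; split=> -[i j] /=.
  by case=> -[].
by case=> Pi Qj; split=> //; split=> //; exists i.
Qed.

(** * Linear maps on free modules *)

Section Linear.
Variable k : fieldType.
Implicit Types U V W : lmodType k.

Lemma linear0_fun U V (h : U -> V) : linear h -> h 0 = 0.
Proof.
move=> lh; have /eqP := lh 1 0 0.
by rewrite !scale1r addr0 -subr_eq0 opprD addNKr oppr_eq0 => /eqP.
Qed.

Lemma linearZ_fun U V (h : U -> V) c x : linear h -> h (c *: x) = c *: h x.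
Proof. by move=> lh; have := lh c x 0; rewrite (linear0_fun lh) !addr0. Qed.

Lemma linearD_fun U V (h : U -> V) x y : linear h -> h (x + y) = h x + h y.
Proof. by move=> lh; have := lh 1 x y; rewrite !scale1r. Qed.

Lemma linear_sum_fun U V (h : U -> V) (I : Type) (s : seq I) (F : I -> U) :
  linear h -> h (\sum_(i <- s) F i) = \sum_(i <- s) h (F i).
Proof.
move=> lh; elim: s => [|i s IHs]; first by rewrite !big_nil linear0_fun.
by rewrite !big_cons linearD_fun// IHs.
Qed.

Lemma linear_fsum_fun U V (h : U -> V) (I : choiceType) (P : set I)
    (F : I -> U) :
    linear h -> finite_set P ->
  h (\sum_(i \in P) F i) = \sum_(i \in P) h (F i).
Proof. by move=> lh Pfin; rewrite !fsbig_finite// linear_sum_fun. Qed.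

Lemma scaler_fsumr U (I : choiceType) (P : set I) (F : I -> U) c :
  finite_set P -> c *: \sum_(i \in P) F i = \sum_(i \in P) c *: F i.
Proof. by move=> Pfin; rewrite !fsbig_finite// scaler_sumr. Qed.

Lemma linear_comp U V W (g : V -> W) (h : U -> V) :
  linear g -> linear h -> linear (fun x => g (h x)).
Proof. by move=> lg lh c x y; rewrite lh lg. Qed.

Lemma linear_scalel U V (e : U -> k) (v : V) :
  scalar e -> linear (fun x => e x *: v).
Proof. by move=> le a x y; rewrite le scalerDl scalerA. Qed.

Lemma lext_linear_fun (B : choiceType) U V (G : B -> U -> V) (a : {malg k[B]}) :
  (forall x, linear (G x)) -> linear (fun u => lext (fun x => G x u) a).
Proof.
move=> lG c u v; rewrite /lext scaler_sumr -big_split /=; apply: eq_bigr => x _.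
by rewrite lG scalerDr !scalerA mulrC.
Qed.

Lemma tlift_linear_fun (B B' : choiceType) U V
    (F : U -> {malg k[B]} -> {malg k[B']} -> V) t :
    (forall a b, linear (fun u => F u a b)) ->
  linear (fun u => tlift (F u) t).
Proof. by move=> lF; apply: lext_linear_fun => -[]. Qed.

Lemma lext_ext2 (B B' : choiceType) W (F G : {malg k[B]} -> {malg k[B']} -> W) :
    (forall b, linear (F^~ b)) -> (forall a, linear (F a)) ->
    (forall b, linear (G^~ b)) -> (forall a, linear (G a)) ->
    (forall x y, F << x >> << y >> = G << x >> << y >>) ->
  forall a b, F a b = G a b.
Proof.
move=> Fl Fr Gl Gr FG a b; move: a; apply: lext_ext => // x.
by move: b; apply: lext_ext.
Qed.

Section TensorProductAlgebra.
Variables (B B' : choiceType).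
Local Notation M := {malg k[B]}.
Local Notation M' := {malg k[B']}.
Variables (m : M -> M -> M) (m' : M' -> M' -> M').

Lemma tmul_linearl t : linear (fun s => tmul m m' s t).
Proof. by move=> c s s'; rewrite /tmul tlift_linear. Qed.

Lemma tmul_linearr s : linear (tmul m m' s).
Proof.
apply: (tlift_linear_fun (F := fun t a a' =>
  tlift (fun b b' => tensor (m a b) (m' a' b')) t)) => a a' c t t'.
by rewrite tlift_linear.
Qed.

Lemma tmulU x y : tmul m m' << x >> << y >> =
  tensor (m << x.1 >> << y.1 >>) (m' << x.2 >> << y.2 >>).
Proof. by rewrite /tmul /tlift !lextU. Qed.

End TensorProductAlgebra.

Lemma scalemU (B : choiceType) (c : k) (x : B) : c *: << x >> = << c *g x >>.
Proof. by apply/malgP => y; rewrite mcoeffZ !mcoeffU mulrnAr mulr1. Qed.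

End Linear.

(** * Factorisations of morphisms into two factors *)

Section Category.
Variable C : category.
Implicit Types f g h : C.

Lemma Id_idm x : Id C (idm x).
Proof. by exists x. Qed.

Lemma Id_srcE f : Id C f -> f = idm (src f).
Proof. by case=> x _ <-; rewrite src_idm. Qed.

Lemma Id_tgtE f : Id C f -> f = idm (tgt f).
Proof. by case=> x _ <-; rewrite tgt_idm. Qed.

Lemma comp_Id f g : Id C g -> src f = tgt g -> comp f g = f.
Proof. by move=> /Id_tgtE {2}-> <-; rewrite compm1. Qed.

Lemma Id_comp f g : Id C f -> src f = tgt g -> comp f g = g.
Proof. by move=> /Id_srcE {2}-> ->; rewrite comp1m. Qed.

Lemma N2_src f p : N2 f p -> src p.2 = src f.
Proof. by case=> e <-; rewrite src_comp. Qed.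

Lemma N2_tgt f p : N2 f p -> tgt p.1 = tgt f.
Proof. by case=> e <-; rewrite tgt_comp. Qed.

Lemma N2_idl f : N2 f (idm (tgt f), f).
Proof. by split=> /=; rewrite ?src_idm ?comp1m. Qed.

Lemma N2_idr f : N2 f (f, idm (src f)).
Proof. by split=> /=; rewrite ?tgt_idm ?compm1. Qed.

Lemma N2_Idl f p : N2 f p -> Id C p.1 -> p = (idm (tgt f), f).
Proof.
case: p => a b fab /= ida; rewrite -(N2_tgt fab) -(Id_tgtE ida).
by case: fab => /= e <-; rewrite Id_comp.
Qed.

Lemma N2_Idr f p : N2 f p -> Id C p.2 -> p = (f, idm (src f)).
Proof.
case: p => a b fab /= idb; rewrite -(N2_src fab) -(Id_srcE idb).
by case: fab => /= e <-; rewrite comp_Id.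
Qed.

(** Both sides run over the factorisations of [f] into three morphisms; [h] and [h'] rebracket them.
    Coassociativity and the associativity of convolution both come down to this. *)
Lemma N2_assoc (W : zmodType) (F : C -> C -> C -> W) f : locally_finite C ->
  \sum_(p \in N2 f) \sum_(q \in N2 p.1) F q.1 q.2 p.2 =
  \sum_(p \in N2 f) \sum_(q \in N2 p.2) F p.1 q.1 q.2.
Proof.
move=> Cfin; rewrite !(@pair_fsbig_dep _ _ _ _ (fun p => N2 _)) //.
pose h (x : (C * C) * (C * C)) := ((comp x.1.1 x.2.1, x.2.2), (x.1.1, x.2.1)).
pose h' (x : (C * C) * (C * C)) := ((x.2.1, comp x.2.2 x.1.2), (x.2.2, x.1.2)).
apply: (fsum_can (h := h) (h' := h')).
- move=> [[a b] [c d]] [[/= ab <-] [cd bE]]; subst b.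
  by rewrite tgt_comp in ab => //; do !split; rewrite //= ?src_comp ?compA.
- move=> [[a b] [c d]] [[/= ab <-] [cd aE]]; subst a.
  by rewrite src_comp in ab => //; do !split; rewrite //= ?tgt_comp ?compA.
- by move=> [[a b] [c d]] [[/= ab fE] [cd bE]]; rewrite /h' /h /= bE.
- by move=> [[a b] [c d]] [[/= ab fE] [cd bE]]; rewrite /h' /h /= bE.
Qed.

End Category.

(** * Incidence coalgebras and algebras *)

Section IncidenceCoalgebra.
Variables (k : fieldType) (C : category) (lam : k).
Hypotheses (Cfin : locally_finite C) (lam0 : lam != 0).
Local Notation A3 := {malg k[(C * C * C)%type]}.
Local Notation D := (inc_Delta k C lam).
Local Notation e := (inc_eps k C lam).

Lemma inc_Delta_linear : linear D.
Proof. exact: lext_linear. Qed.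

Lemma inc_eps_linear : scalar e.
Proof. exact: (@lext_linear k C k^o). Qed.

Lemma inc_epsU f : e << f >> = if f \in Id C then lam else 0.
Proof. exact: (@lextU k C k^o). Qed.

Lemma lext_Delta (W : lmodType k) (G : C * C -> W) f :
  lext G (D << f >>) = lam^-1 *: \sum_(p \in N2 f) G p.
Proof.
rewrite /inc_Delta lextU (linearZ_fun _ _ (lext_linear G)).
rewrite (linear_fsum_fun _ (lext_linear G)) //.
by congr (_ *: _); apply: eq_fsbigr => p _; rewrite lextU.
Qed.

Lemma tlift_Delta (W : lmodType k) (F : {malg k[C]} -> {malg k[C]} -> W) f :
  tlift F (D << f >>) = lam^-1 *: \sum_(p \in N2 f) F << p.1 >> << p.2 >>.
Proof. exact: lext_Delta. Qed.

(** The counit kills every term except the one whose first factor is an identity, and [f] has only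
    one such factorisation. *)
Lemma fsum_N2_Idl (W : lmodType k) (F : C * C -> W) f :
  \sum_(p \in N2 f) e << p.1 >> *: F p = lam *: F (idm (tgt f), f).
Proof.
rewrite (fsbigD1 (idm (tgt f), f)) //=; last exact: N2_idl.
rewrite inc_epsU mem_set; last exact: Id_idm.
rewrite fsbig1 ?addr0 // => p [/= pN /eqP np].
rewrite inc_epsU memNset ?scale0r // => /(N2_Idl pN) pE.
by rewrite pE eqxx in np.
Qed.

Lemma fsum_N2_Idr (W : lmodType k) (F : C * C -> W) f :
  \sum_(p \in N2 f) e << p.2 >> *: F p = lam *: F (f, idm (src f)).
Proof.
rewrite (fsbigD1 (f, idm (src f))) //=; last exact: N2_idr.
rewrite inc_epsU mem_set; last exact: Id_idm.
rewrite fsbig1 ?addr0 // => p [/= pN /eqP np].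
rewrite inc_epsU memNset ?scale0r // => /(N2_Idr pN) pE.
by rewrite pE eqxx in np.
Qed.

Lemma Delta2U f :
  Delta2 D << f >> = (lam^-1 * lam^-1) *:
    \sum_(p \in N2 f) \sum_(q \in N2 p.1) (<< (q.1, q.2, p.2) >> : A3).
Proof.
rewrite /Delta2 /tmap tlift_Delta -scalerA; congr (_ *: _).
rewrite scaler_fsumr //.
apply: eq_fsbigr => p _.
rewrite [tensor _ _](lext_Delta
  (fun x => lext (fun y => << (x, y) >> : A3) << p.2 >>)).
congr (_ *: _); apply: eq_fsbigr => q _.
by rewrite lextU -surjective_pairing.
Qed.

Lemma inc_coalgebra : is_coalgebra D e.
Proof.
have tassocL : linear (@tassoc k C C C) by exact: tlift_linear.
split.
- exact: inc_Delta_linear.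
- exact: inc_eps_linear.
- apply: lext_ext => [||f].
  + by apply: linear_comp inc_Delta_linear; exact: tlift_linear.
  + apply: linear_comp; first exact: tlift_linear.
    by apply: linear_comp inc_Delta_linear; exact: tlift_linear.
  + rewrite Delta2U (N2_assoc (fun a b c => << (a, b, c) >> : A3)) //.
    rewrite /tmap tlift_Delta (linearZ_fun _ _ tassocL).
    rewrite -scalerA; congr (_ *: _).
    rewrite (linear_fsum_fun _ tassocL) //.
    rewrite scaler_fsumr //.
    apply: eq_fsbigr => p _.
    rewrite /inc_Delta lextU (linearZ_fun _ _ (tensor_linearr _)).
    rewrite (linear_fsum_fun _ (tensor_linearr _)) //.
    rewrite (linearZ_fun _ _ tassocL) (linear_fsum_fun _ tassocL);
      last exact: Cfin.
    congr (_ *: _); apply: eq_fsbigr => q _.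
    by rewrite tensorU /tassoc /tlift !lextU !tensorU.
- apply: lext_ext => [|//|f].
    by apply: linear_comp inc_Delta_linear; exact: tlift_linear.
  rewrite tlift_Delta (fsum_N2_Idl (fun p => << p.2 >> : {malg k[C]})).
  by rewrite scalerA mulVf // scale1r.
- apply: lext_ext => [|//|f].
    by apply: linear_comp inc_Delta_linear; exact: tlift_linear.
  rewrite tlift_Delta (fsum_N2_Idr (fun p => << p.1 >> : {malg k[C]})).
  by rewrite scalerA mulVf // scale1r.
Qed.

End IncidenceCoalgebra.

Section IncidenceAlgebra.
Variables (k : fieldType) (C : monoidal_cat).
Local Notation A := {malg k[C]}.
Local Notation A2 := {malg k[(C * C)%type]}.
Local Notation mul := (inc_mul k C).
Local Notation one := (inc_one k C).

Lemma inc_mulU (f g : C) : mul << f >> << g >> = << mprod C (f, g) >>.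
Proof. by rewrite /inc_mul !lextU. Qed.

Lemma inc_mul_linearl (b : A) : linear (mul^~ b).
Proof. exact: lext_linear. Qed.

Lemma inc_mul_linearr (a : A) : linear (mul a).
Proof. by apply: lext_linear_fun => x; exact: lext_linear. Qed.

Lemma inc_algebra : is_algebra mul one.
Proof.
have linl := inc_mul_linearl; have linr := inc_mul_linearr.
split; [exact: linl|exact: linr| | |].
- move=> a b c; move: a b; apply: lext_ext2 => [b|a|b|a|f g].
  + exact: linl.
  + exact: linear_comp (linr _) (linl _).
  + by apply: linear_comp (linl b) => //; exact: linl.
  + by apply: linear_comp (linr _); exact: linl.
  move: c; apply: lext_ext => [||h].
  + exact: linear_comp (linr _) (linr _).
  + exact: linr.
  + by rewrite !inc_mulU mprod_morA.
- by apply: lext_ext => [|//|f]; [exact: linr|rewrite inc_mulU mprod_mor1x].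
- by apply: lext_ext => [|//|f]; [exact: linl|rewrite inc_mulU mprod_morx1].
Qed.

Section Delta.
Variable lam : k.
Hypotheses (Cfin : locally_finite C) (lam0 : lam != 0).
Local Notation D := (inc_Delta k C lam).
Local Notation e := (inc_eps k C lam).

(** The product of two coproducts carries [lam^-1] twice, the coproduct of a product only once; the
    factor [lam] in the hypothesis makes up for the difference. Under ULF it is 1, in a 2-group it
    is the size of the fibres of the product on factorisations. *)
Lemma inc_DeltaM :
    (forall (f g : C) (F : C * C -> A2),
       \sum_(p \in N2 f) \sum_(q \in N2 g)
          F (mprod C (p.1, q.1), mprod C (p.2, q.2)) =
       lam *: \sum_(p \in N2 (mprod C (f, g))) F p) ->
  forall a b, D (mul a b) = tmul mul mul (D a) (D b).
Proof.
move=> sumM; have linD := @inc_Delta_linear k C lam.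
apply: lext_ext2 => [b|a|b|a|f g].
- exact: linear_comp linD (inc_mul_linearl _).
- exact: linear_comp linD (inc_mul_linearr _).
- exact: linear_comp (tmul_linearl _ _ _) linD.
- exact: linear_comp (tmul_linearr _ _ _) linD.
rewrite inc_mulU /tmul (tlift_Delta _ Cfin).
have inner (p : C * C) : tlift (fun b b' : A =>
      tensor (mul << p.1 >> b) (mul << p.2 >> b')) (D << g >>) =
    lam^-1 *: \sum_(q \in N2 g)
      (<< (mprod C (p.1, q.1), mprod C (p.2, q.2)) >> : A2).
  rewrite tlift_Delta; last exact: Cfin.
  congr (_ *: _); apply: eq_fsbigr => q _.
  by rewrite !inc_mulU tensorU.
under eq_fsbigr do rewrite inner.
rewrite -scaler_fsumr; last exact: Cfin.
rewrite (sumM _ _ (fun p => << p >> : A2)) 2!scalerA -mulrA mulVf // mulr1.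
by rewrite /inc_Delta lextU.
Qed.

End Delta.
End IncidenceAlgebra.

(** * Lengths in Moebius categories *)

Section Moebius.
Variable C : category.
Implicit Types f g : C.

Lemma hatNP f (s : seq C) :
  hatN f s <-> composes_to f s /\ (forall a, a \in s -> ~ Id C a).
Proof.
split=> [[n _ [t [Nt It] <-]]|[fs sI]].
  by split=> // a /tnthP[i ->].
exists (size s) => //; exists (in_tuple s) => //; split=> // i.
by apply: sI; exact: mem_tnth.
Qed.

Lemma composes_to_cat f g (s t : seq C) :
    composes_to f s -> composes_to g t -> src f = tgt g ->
  composes_to (comp f g) (s ++ t).
Proof.
elim: s f => [|a s IHs] f /=.
  by move=> /set_mem If gt fg; rewrite Id_comp.
move=> [h [hs ah <-]] gt; rewrite src_comp// => hg.
exists (comp h g); split; [exact: IHs|by rewrite tgt_comp|exact: compA].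
Qed.

Lemma hatN_cat f g (s t : seq C) :
  hatN f s -> hatN g t -> src f = tgt g -> hatN (comp f g) (s ++ t).
Proof.
move=> /hatNP[fs sI] /hatNP[gt tI] fg; apply/hatNP; split.
  exact: composes_to_cat.
by move=> a; rewrite mem_cat => /orP[/sI|/tI].
Qed.

Lemma hatN1 f : ~ Id C f -> hatN f [:: f].
Proof.
move=> fI; apply/hatNP; split=> [|a]; last by rewrite inE => /eqP->.
exists (idm (src f)); split; rewrite /= ?tgt_idm ?compm1 //.
exact/mem_set/Id_idm.
Qed.

Lemma hatN_nonempty f : exists s, hatN f s.
Proof.
have [If|nIf] := pselect (Id C f); last by exists [:: f]; exact: hatN1.
by exists [::]; apply/hatNP; split=> //=; exact/mem_set.
Qed.

Hypothesis Cmoeb : moebius C.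

(** The Möbius condition makes the set of factorisations finite, which bounds their sizes. *)
Lemma longest_factorisation f :
  exists2 s, hatN f s & forall t, hatN f t -> (size t <= size s)%N.
Proof.
pose P n := `[< exists2 s, hatN f s & size s = n >].
have [|n|n /asboolP[s sN <-] smax] :=
  @ex_maxnP P (\max_(s <- fset_set (hatN f)) size s)%N.
- by have [s sN] := hatN_nonempty f; exists (size s); apply/asboolP; exists s.
- move=> /asboolP[s sN <-]; apply: leq_bigmax_seq => //.
  by rewrite in_fset_set ?mem_set //; exact: Cmoeb.
- by exists s => // t tN; apply: smax; apply/asboolP; exists t.
Qed.

(** The value does not depend on the witness chosen by [cid2], since all longest factorisations have
    the same size. *)
Definition len f : nat := size (s2val (cid2 (longest_factorisation f))).

Lemma len_max f s : hatN f s -> (size s <= len f)%N.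
Proof. by rewrite /len; case: cid2 => /= t _; apply. Qed.

Lemma len_attained f : exists2 s, hatN f s & size s = len f.
Proof. by rewrite /len; case: cid2 => /= s sN _; exists s. Qed.

(** Appending the non-identity [p.2] to a longest factorisation of [p.1] gives a factorisation of
    [f]. *)
Lemma len_lt f p : N2 f p -> ~ Id C p.2 -> (len p.1 < len f)%N.
Proof.
case: p => a b [/= ab <-] bI; have [s sN <-] := len_attained a.
by have := len_max (hatN_cat sN (hatN1 bI) ab); rewrite size_cat addn1.
Qed.

(** If neither factor were an identity, appending both to a longest factorisation of [idm x] would
    give one that is longer by two. *)
Lemma N2_idm x p : N2 (idm x : C) p -> p = (idm x, idm x).
Proof.
move=> pN; have := N2_Idl pN; have := N2_Idr pN; rewrite src_idm tgt_idm.
have [I2 /(_ I2)->//|nI2 _] := pselect (Id C p.2).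
have [I1 /(_ I1)->//|nI1 _] := pselect (Id C p.1).
have [s sN sE] := len_attained (idm x).
have := hatN_cat (hatN1 nI1) (hatN1 nI2) pN.1; rewrite pN.2 => abN.
have := hatN_cat sN abN; rewrite src_idm tgt_idm.
rewrite comp_Id ?src_idm ?tgt_idm//; last exact: Id_idm.
by move=> /(_ erefl)/len_max; rewrite size_cat sE addn2 ltnNge leqnSn.
Qed.

(** A factorisation other than the two trivial ones is a sequence of size two in [hatN f]. *)
Lemma moebius_locally_finite : locally_finite C.
Proof.
(* [i] only serves as the default value of [nth]. *)
move=> f; pose i := idm (tgt f).
pose pr (s : seq C) := (nth i s 0, nth i s 1).
apply: (@sub_finite_set _ _
  ([set (idm (tgt f), f); (f, idm (src f))] `|` pr @` hatN f)).
  move=> p pN; have [I2|nI2] := pselect (Id C p.2).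
    by left; right; exact: N2_Idr.
  have [I1|nI1] := pselect (Id C p.1); first by left; left; exact: N2_Idl.
  right; exists [:: p.1; p.2]; last by rewrite /pr /= -surjective_pairing.
  by rewrite -pN.2; exact: hatN_cat (hatN1 nI1) (hatN1 nI2) pN.1.
by rewrite finite_setU; split; [exact: finite_set2|exact/finite_image/Cmoeb].
Qed.

(** * Simple subcoalgebras are spanned by identity morphisms *)

Section Pointed.
Variable k : fieldType.
Local Notation A := {malg k[C]}.
Local Notation D := (inc_Delta k C 1).
Let Cfin := moebius_locally_finite.

(** A term survives only if [p.1] is [f]. A non-identity [p.2] would then make [g] longer than [f],
    so [p] is the trivial factorisation and [g] is [f]. *)
Lemma fsum_N2_longest (f g : C) : (len g <= len f)%N ->
  \sum_(p \in N2 g) (<< p.1 >> : A)@_f *: (<< p.2 >> : A) =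
  (g == f)%:R *: << idm (src f) >>.
Proof.
move=> gf.
have coef_neq0 p : N2 g p -> p.1 = f -> g = f /\ p = (f, idm (src f)).
  move=> pN p1; have I2 : Id C p.2.
    by apply: contrapT => /(len_lt pN); rewrite p1 ltnNge gf.
  by have pE := N2_Idr pN I2; move: p1; rewrite pE => /= ->.
have [gE|nfg] := eqVneq g f; last first.
  rewrite scale0r; apply: fsbig1 => p pN; rewrite mcoeffU.
  have [p1|] := eqVneq p.1 f; last by rewrite scale0r.
  by have [gE] := coef_neq0 _ pN p1; rewrite gE eqxx in nfg.
rewrite (fsbigD1 (f, idm (src f))) ?mcoeffU ?eqxx //=;
  last by rewrite gE; exact: N2_idr.
rewrite fsbig1 ?addr0 // => p [/= pN /eqP np]; rewrite mcoeffU.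
have [p1|] := eqVneq p.1 f; last by rewrite scale0r.
by have [_ pE] := coef_neq0 _ pN p1; rewrite pE eqxx in np.
Qed.

Lemma longest_in_supp (a : A) : a != 0 ->
  exists2 f, f \in msupp a & forall g, g \in msupp a -> (len g <= len f)%N.
Proof.
move=> a0; pose P n := has (fun g => len g == n) (msupp a).
have [|n|n /hasP[f fa /eqP fn] smax] :=
  @ex_maxnP P (\max_(g <- msupp a) len g)%N.
- have /fset0Pn[f fa] : (msupp a != fset0)%fset.
    by apply: contra_neq a0 => supp0; rewrite [a]monalgE supp0 big_seq_fset0.
  by exists (len f); apply/hasP; exists f.
- by move=> /hasP[f fa /eqP <-]; exact: leq_bigmax_seq.
- exists f => // g ga; rewrite fn; apply: smax.
  by apply/hasP; exists g.
Qed.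

Lemma subspace_sum (E : set A) (I : eqType) (s : seq I) (F : I -> A) :
    is_subspace E -> (forall i, i \in s -> E (F i)) -> E (\sum_(i <- s) F i).
Proof.
case=> E0 Elin; elim: s => [|i s IHs] EF; first by rewrite big_nil.
rewrite big_cons -[F i]scale1r; apply: Elin; first exact/EF/mem_head.
by apply: IHs => j js; apply: EF; rewrite inE js orbT.
Qed.

(* For f of maximal length in the support of a, the only term of Delta a with
   first factor f is a@_f f (x) id. *)
Lemma subcoalgebra_idm (E : set A) (a : A) :
  is_subcoalgebra D E -> E a -> a != 0 -> exists x, E << idm x >>.
Proof.
case=> Esub EDelta Ea /longest_in_supp[f fa fmax].
(* [phi] applies the coordinate functional of [f] to the first tensor factor, hence maps the tensor
   square of [E] into [E]. *)
exists (src f); pose phi := tlift (fun u v : A => u@_f *: v).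
have phiL : linear phi by exact: tlift_linear.
have phiT u v : phi (tensor u v) = u@_f *: v.
  rewrite /phi tliftT // => [w c u' v'|w c u' v'].
    by rewrite mcoeffD mcoeffZ scalerDl scalerA.
  by rewrite scalerDr !scalerA mulrC.
have EZ c u : E u -> E (c *: u).
  by move=> Eu; rewrite -[_ *: _]addr0; apply: Esub.2 => //; exact: Esub.1.
have Ephi : E (phi (D a)).
  have [s [sE ->]] := EDelta _ Ea.
  rewrite linear_sum_fun //; apply: subspace_sum => // p /sE[_ Ep2].
  by rewrite phiT; exact: EZ.
have phiE : phi (D a) = a@_f *: << idm (src f) >>.
  rewrite {1}[a]monalgE.
  have DL := @inc_Delta_linear k C 1.
  rewrite (linear_sum_fun _ _ DL) (linear_sum_fun _ _ phiL).
  (* Only the basis element [f] contributes: the others in the support are no longer than [f], so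
     [fsum_N2_longest] gives zero for them. *)
  rewrite (big_fsetD1 f) //= big1_fset ?addr0 => [|g + _].
    rewrite -scalemU (linearZ_fun _ _ DL) (linearZ_fun _ _ phiL).
    congr (_ *: _).
    rewrite /phi (tlift_Delta _ Cfin) invr1 scale1r fsum_N2_longest //.
    by rewrite eqxx scale1r.
  rewrite in_fsetD1 => /andP[gf ga].
  rewrite -scalemU (linearZ_fun _ _ DL) (linearZ_fun _ _ phiL).
  rewrite /phi (tlift_Delta _ Cfin) fsum_N2_longest; last exact: fmax.
  by rewrite (negPf gf) scale0r !scaler0.
rewrite phiE in Ephi; have := EZ (a@_f)^-1 _ Ephi.
by rewrite scalerA mulVf ?scale1r // mcoeff_neq0.
Qed.

(** Identities are group-like because they factor only trivially. *)
Lemma Delta_idm x : D << idm x >> = << (idm x, idm x) >>.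
Proof.
rewrite /inc_Delta lextU invr1 scale1r.
suff -> : N2 (idm x : C) = [set (idm x, idm x)] by rewrite fsbig_set1.
apply/seteqP; split=> [p /N2_idm //|p ->].
split; rewrite /= ?src_idm ?tgt_idm // comp_Id ?src_idm ?tgt_idm //.
exact: Id_idm.
Qed.

Lemma line_subcoalgebra x :
  is_subcoalgebra D (range (fun c : k => c *: << idm x >>)).
Proof.
split; first split.
- by exists 0; rewrite ?scale0r.
- by move=> c _ _ [a _ <-] [b _ <-]; exists (c * a + b);
    rewrite ?scalerDl ?scalerA.
move=> _ [c _ <-]; exists [:: (c *: << idm x >>, << idm x >>)]; split.
  move=> p; rewrite inE => /eqP-> /=; split; first by exists c.
  by exists 1; rewrite ?scale1r.
rewrite big_seq1 (linearZ_fun _ _ (@inc_Delta_linear k C 1)) Delta_idm.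
by rewrite (linearZ_fun _ _ (tensor_linearl _)) tensorU.
Qed.

(** A simple subcoalgebra contains some [idm x], hence the line through it; that line is a nonzero
    subcoalgebra, so simplicity forces equality. *)
Lemma inc_pointed : is_pointed D.
Proof.
move=> E [Ecoalg E0 Emin].
have [a Ea a0] : exists2 a, E a & a != 0.
  apply: contrapT => noa; apply: E0; apply/seteqP; split=> [a Ea|_ ->].
    by apply: contrapT => /eqP a0; apply: noa; exists a.
  exact: Ecoalg.1.1.
have [x Ex] := subcoalgebra_idm Ecoalg Ea a0.
have idx0 : (<< idm x >> : A) != 0 by rewrite monalgU_eq0 oner_eq0.
exists << idm x >>; first exact/eqP.
have [|E0'|//] := Emin _ (line_subcoalgebra x).
  move=> _ [c _ <-]; rewrite -[_ *: _]addr0.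
  by apply: Ecoalg.1.2 => //; exact: Ecoalg.1.1.
have : [set (0 : A)] << idm x >> by rewrite -E0'; exists 1; rewrite ?scale1r.
by move/eqP; rewrite (negPf idx0).
Qed.

End Pointed.
End Moebius.

(** * Convolution inverses *)

Section Convolution.
Variables (C : category) (k : fieldType) (B : choiceType).
Local Notation A := {malg k[B]}.
Variables (mul : A -> A -> A) (one : A).
Hypotheses (Cmoeb : moebius C) (Halg : is_algebra mul one).
Local Notation len := (len Cmoeb).
Let Cfin := moebius_locally_finite Cmoeb.
Let mulA := alg_assoc Halg.
Let mul1a := alg_unitl Halg.
Let mula1 := alg_unitr Halg.

(** This is the convolution product of linear maps from the incidence coalgebra with scaling 1 to
    the algebra, each given by its values on morphisms; [conv1] is its unit. *)
Definition conv (phi psi : C -> A) (f : C) : A :=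
  \sum_(p \in N2 f) mul (phi p.1) (psi p.2).

Definition conv1 (f : C) : A := if f \in Id C then one else 0.

Lemma convA phi psi chi : conv (conv phi psi) chi =1 conv phi (conv psi chi).
Proof.
move=> f; rewrite /conv.
transitivity (\sum_(p \in N2 f) \sum_(q \in N2 p.1)
    mul (mul (phi q.1) (psi q.2)) (chi p.2)).
  apply: eq_fsbigr => p _.
  by rewrite (linear_fsum_fun _ (alg_linearl Halg _)) //; exact: Cfin.
rewrite (N2_assoc (fun a b c => mul (mul (phi a) (psi b)) (chi c))) //.
apply: eq_fsbigr => p _.
rewrite (linear_fsum_fun _ (alg_linearr Halg _)); last exact: Cfin.
by apply: eq_fsbigr => q _; rewrite mulA.
Qed.

Lemma conv1l phi : conv conv1 phi =1 phi.
Proof.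
move=> f; rewrite /conv (fsbigD1 (idm (tgt f), f)) //=; last exact: N2_idl.
rewrite {1}/conv1 mem_set ?mul1a; last exact: Id_idm.
rewrite fsbig1 ?addr0 // => p [/= pN /eqP np].
rewrite /conv1 memNset ?(linear0_fun (alg_linearl Halg _)) // => I1.
by rewrite (N2_Idl pN I1) eqxx in np.
Qed.

Lemma conv1r phi : conv phi conv1 =1 phi.
Proof.
move=> f; rewrite /conv (fsbigD1 (f, idm (src f))) //=; last exact: N2_idr.
rewrite {1}/conv1 mem_set ?mula1; last exact: Id_idm.
rewrite fsbig1 ?addr0 // => p [/= pN /eqP np].
rewrite /conv1 memNset ?(linear0_fun (alg_linearr Halg _)) // => I2.
by rewrite (N2_Idr pN I2) eqxx in np.
Qed.

Section LeftInverse.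
Variables (phi : C -> A) (v : obj C -> A).

(** In the equation [conv linv phi f = conv1 f], the factorisation [(f, idm (src f))] contributes
    [linv f] times the value of [phi] at an identity. Solving for [linv f] leaves shorter first
    factors, so a fuel [n] above [len f] suffices and the value 0 is then never reached. *)
Fixpoint linv_rec n (f : C) : A :=
  if n is n'.+1 then
    mul (conv1 f - \sum_(p \in N2 f `\ (f, idm (src f)))
                     mul (linv_rec n' p.1) (phi p.2)) (v (src f))
  else 0.

Definition linv f := linv_rec (len f).+1 f.

Lemma len_ltD1 f p : (N2 f `\ (f, idm (src f))) p -> (len p.1 < len f)%N.
Proof. by case=> pN np; apply: len_lt => // /(N2_Idr pN). Qed.

Lemma linv_rec_stable n m f :
  (len f < n)%N -> (len f < m)%N -> linv_rec n f = linv_rec m f.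
Proof.
elim: n m f => [|n IHn] [|m] f // fn fm; congr (mul (_ - _) _).
apply: eq_fsbigr => p /set_mem /len_ltD1 pf; congr mul.
by apply: IHn; apply: leq_trans pf _.
Qed.

Lemma linvE f : linv f =
  mul (conv1 f - \sum_(p \in N2 f `\ (f, idm (src f)))
                   mul (linv p.1) (phi p.2)) (v (src f)).
Proof.
congr (mul (_ - _) _).
apply: eq_fsbigr => p /set_mem /len_ltD1 pf; congr mul.
exact: linv_rec_stable.
Qed.

Hypothesis vphi : forall x, mul (v x) (phi (idm x)) = one.

Lemma linv_convl : conv linv phi =1 conv1.
Proof.
move=> f; rewrite /conv (fsbigD1 (f, idm (src f))) //=; last exact: N2_idr.
by rewrite {1}linvE -mulA vphi mula1 subrK.
Qed.

(** This allows [linv] to be applied a second time, to the left inverse itself, whose values at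
    identities are thus invertible too. *)
Lemma linv_idm x : linv (idm x) = v x.
Proof.
rewrite linvE src_idm fsbig1 => [|p [pN []]]; last by rewrite (N2_idm Cmoeb pN).
by rewrite /conv1 mem_set ?subr0 ?mul1a //; exact: Id_idm.
Qed.

End LeftInverse.

(* If sigma is a left inverse of phi and rho one of sigma, then rho = phi. *)
Lemma conv_inverse (phi : C -> A) (v : obj C -> A) :
    (forall x, mul (v x) (phi (idm x)) = one) ->
    (forall x, mul (phi (idm x)) (v x) = one) ->
  exists2 sigma, conv sigma phi =1 conv1 & conv phi sigma =1 conv1.
Proof.
move=> vphi phiv; pose sigma := linv phi v.
exists sigma; first exact: linv_convl.
pose rho := linv sigma (fun x => phi (idm x)).
have sigma_idm x : sigma (idm x) = v x by exact: linv_idm.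
have rhosigma : conv rho sigma =1 conv1.
  by apply: linv_convl => x; rewrite sigma_idm.
suff rhoE : rho =1 phi.
  by move=> f; rewrite -rhosigma; apply: eq_fsbigr => p _; rewrite rhoE.
move=> f; rewrite -conv1r -[RHS]conv1l.
transitivity (conv rho (conv sigma phi) f).
  by apply: eq_fsbigr => p _; rewrite linv_convl.
by rewrite -convA; apply: eq_fsbigr => p _; rewrite rhosigma.
Qed.

End Convolution.

(** * The bialgebra and Hopf algebra of a Möbius monoidal category *)

Section Hopf.
Variables (k : fieldType) (C : monoidal_cat).
Hypothesis Cmoeb : moebius C.
Local Notation A := {malg k[C]}.
Local Notation A2 := {malg k[(C * C)%type]}.
Local Notation mul := (inc_mul k C).
Local Notation one := (inc_one k C).
Local Notation D := (inc_Delta k C 1).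
Local Notation e := (inc_eps k C 1).
Let Cfin := moebius_locally_finite Cmoeb.

Section Bialgebra.
Hypothesis Culf : ULF (mprod C).

(** ULF identifies the factorisations of [mprod C (f, g)] with those of the pair [(f, g)] in the
    product category, which are pairs of factorisations up to the exchange [h] of the two middle
    entries. *)
Lemma ULF_sum (f g : C) (F : C * C -> A2) :
  \sum_(p \in N2 f) \sum_(q \in N2 g)
     F (mprod C (p.1, q.1), mprod C (p.2, q.2)) =
  \sum_(p \in N2 (mprod C (f, g))) F p.
Proof.
rewrite (reindex_fsbig _ _ _ _ (Culf (f, g))).
rewrite (@pair_fsbig_dep _ _ _ _ (fun=> N2 g)
  (fun p q => F (mprod C (p.1, q.1), mprod C (p.2, q.2)))) //.
pose h (x : (C * C) * (C * C)) := ((x.1.1, x.2.1), (x.1.2, x.2.2)).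
symmetry; apply: (fsum_can (h := h) (h' := h)).
- by move=> [[a b] [c d]] [[/= ab fE] [cd gE]]; split;
    rewrite /= ?ab ?cd ?fE ?gE.
- by move=> [[a b] [c d]] [[/= ab cd] [fE gE]].
- by move=> [[a b] [c d]].
- by move=> [[a b] [c d]].
Qed.

(** This makes the counit multiplicative. If the product is an identity, it has a single
    factorisation, so both trivial factorisations of [(f, g)] have the same image; injectivity makes
    them equal. *)
Lemma ULF_Id (f g : C) : Id C (mprod C (f, g)) <-> Id C f /\ Id C g.
Proof.
split=> [[x _ fgE]|[[x _ <-] [y _ <-]]]; last first.
  by exists (fobj (mprod C) (x, y)) => //; rewrite -(fmor_idm (mprod C) (x, y)).
have [maps inj _] := Culf (f, g).
pose fg : prod_cat C C := (f, g).
have N1 := N2_idl fg; have N1' := N2_idr fg.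
have : (idm (tgt fg), fg) = (fg, idm (src fg)).
  apply: inj; try exact/mem_set.
  have := maps _ N1; have := maps _ N1'; rewrite -fgE.
  by move=> /= /(N2_idm Cmoeb)-> /(N2_idm Cmoeb)->.
by case=> <- <- _ _; split; exact: Id_idm.
Qed.

Lemma inc_bialgebra : is_bialgebra mul one D e.
Proof.
have D1 : D one = tensor one one by rewrite /inc_one tensorU Delta_idm.
split; [exact: inc_algebra| | |exact: D1| |].
- by apply: inc_coalgebra; [exact: Cfin|exact: oner_neq0].
- apply: inc_DeltaM; [exact: Cfin|exact: oner_neq0|] => f g F.
  by rewrite scale1r ULF_sum.
- have eL : scalar e by exact: inc_eps_linear.
  have mull (b : A) : linear (mul^~ b) by exact: inc_mul_linearl.
  have mulr (a : A) : linear (mul a) by exact: inc_mul_linearr.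
  apply: (@lext_ext2 k C C k^o (fun a b => e (mul a b)) (fun a b => e a * e b)).
  + by move=> b c a a'; rewrite mull eL.
  + by move=> a c b b'; rewrite mulr eL.
  + by move=> b c a a'; rewrite eL mulrDl -mulrA.
  + by move=> a c b b'; rewrite eL mulrDr mulrCA.
  move=> f g; rewrite inc_mulU !inc_epsU.
  have [/[dup] /ULF_Id[If Ig] Ifg|nI] := pselect (Id C (mprod C (f, g))).
    by rewrite !mem_set // mulr1.
  rewrite memNset //; have [If|nIf] := pselect (Id C f).
    rewrite (@memNset _ (Id C) g) ?mulr0 // => Ig; exact/nI/ULF_Id.
  by rewrite (memNset nIf) mul0r.
- by rewrite /inc_one inc_epsU mem_set //; exact: Id_idm.
Qed.

End Bialgebra.

(** The antipode is the convolution inverse of the identity map of the algebra, given on morphisms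
    by [U]. Its value at [idm x] is invertible because the object [x] is. *)
Lemma inc_Hopf : ULF (mprod C) -> obj_group C ->
  exists sigma, is_Hopf mul one D e sigma.
Proof.
move=> Culf /choice[inv invP].
pose U (f : C) : A := << f >>.
have mulid x y : mul (U (idm x)) (U (idm y)) = U (idm (fobj (mprod C) (x, y))).
  by rewrite inc_mulU -(fmor_idm (mprod C) (x, y)).
have [|x|sigma sigmal sigmar] :=
  conv_inverse Cmoeb (inc_algebra k C) (phi := U)
    (v := fun x => U (idm (inv x))).
- by move=> x; rewrite mulid (invP x).2.
- by rewrite mulid (invP x).1.
(* The convolution unit is the counit followed by the unit of the algebra, as in the antipode
   axioms. *)
have conv1E f : conv1 one f = e << f >> *: one.
  by rewrite inc_epsU /conv1; case: ifP => _; rewrite ?scale1r ?scale0r.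
have DL := @inc_Delta_linear k C 1; have eL := @inc_eps_linear k C 1.
exists (lext sigma); split.
- exact: inc_bialgebra.
- exact: lext_linear.
- apply: lext_ext => [||f].
  + by apply: linear_comp DL; exact: tlift_linear.
  + exact: linear_scalel.
  rewrite (tlift_Delta _ Cfin) invr1 scale1r -conv1E -sigmal.
  by apply: eq_fsbigr => p _; rewrite lextU.
- apply: lext_ext => [||f].
  + by apply: linear_comp DL; exact: tlift_linear.
  + exact: linear_scalel.
  rewrite (tlift_Delta _ Cfin) invr1 scale1r -conv1E -sigmar.
  by apply: eq_fsbigr => p _; rewrite lextU.
Qed.

End Hopf.

(** * Strict 2-groups *)

Section TwoGroup.
Variable C : monoidal_cat.
Local Notation "f ** g" := (mprod C (f, g)) (at level 40, left associativity).
Local Notation "x *o y" := (fobj (mprod C) (x, y))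
  (at level 40, left associativity).
Local Notation u := (munit C).
Implicit Types (f g h : C) (p q : C * C).

Lemma src_mul f g : src (f ** g) = src f *o src g.
Proof. exact: (src_fmor (mprod C) (f, g)). Qed.

Lemma tgt_mul f g : tgt (f ** g) = tgt f *o tgt g.
Proof. exact: (tgt_fmor (mprod C) (f, g)). Qed.

Lemma idm_mul x y : idm x ** idm y = idm (x *o y).
Proof. exact: (fmor_idm (mprod C) (x, y)). Qed.

Lemma interchange f f' g g' : src f = tgt f' -> src g = tgt g' ->
  comp f f' ** comp g g' = comp (f ** g) (f' ** g').
Proof.
move=> ef eg; apply: (@fmor_comp _ _ (mprod C) (f, g) (f', g')).
by rewrite /= ef eg.
Qed.

(* Eckmann-Hilton *)
Lemma mul_comp f g : src f = u -> tgt g = u -> f ** g = comp f g.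
Proof.
move=> fu gu; rewrite -{1}[f]compm1 -{1}[g]comp1m fu gu.
by rewrite interchange ?src_idm ?tgt_idm // mprod_morx1 mprod_mor1x.
Qed.

Lemma mul_comp_op f g : src f = u -> tgt g = u -> g ** f = comp f g.
Proof.
move=> fu gu; rewrite -{1}[f]compm1 -{1}[g]comp1m fu gu.
by rewrite interchange ?src_idm ?tgt_idm // mprod_morx1 mprod_mor1x.
Qed.

(* oi is the inverse of objects for the monoidal product, ci the inverse of
   morphisms for the composition. *)
Variables (oi : obj C -> obj C) (ci : C -> C).
Hypotheses (oiP : forall x, x *o oi x = u /\ oi x *o x = u)
  (ciP : forall f, [/\ src (ci f) = tgt f, tgt (ci f) = src f,
    comp (ci f) f = idm (src f) & comp f (ci f) = idm (tgt f)])
  (Cfin : locally_finite C).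

Let oir x : x *o oi x = u. Proof. by have [] := oiP x. Qed.
Let oil x : oi x *o x = u. Proof. by have [] := oiP x. Qed.
Let src_ci f : src (ci f) = tgt f. Proof. by have [] := ciP f. Qed.
Let tgt_ci f : tgt (ci f) = src f. Proof. by have [] := ciP f. Qed.
Let cil f : comp (ci f) f = idm (src f). Proof. by have [] := ciP f. Qed.
Let cir f : comp f (ci f) = idm (tgt f). Proof. by have [] := ciP f. Qed.

Lemma idmK x f : idm (oi x) ** (idm x ** f) = f.
Proof. by rewrite mprod_morA idm_mul oil mprod_mor1x. Qed.

Lemma idmKV x f : idm x ** (idm (oi x) ** f) = f.
Proof. by rewrite mprod_morA idm_mul oir mprod_mor1x. Qed.

(** Pad [f] with the identity of its source and [idm (oi (src f)) ** g], whose target is the unit,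
    with [idm u]; interchange then gives the composite. *)
Lemma compE f g : src f = tgt g -> comp f g = f ** idm (oi (src f)) ** g.
Proof.
move=> fg; rewrite -mprod_morA -{2}[f]compm1.
rewrite -[idm (oi _) ** g]comp1m tgt_mul tgt_idm -fg oil.
rewrite interchange; last first.
- by rewrite src_idm tgt_mul tgt_idm -fg oil.
- by rewrite tgt_idm.
by rewrite mprod_morx1 idmKV.
Qed.

(** The same argument with the padding on the opposite sides: [g] is preceded by an identity and the
    other factor is followed by one, which reverses the order. *)
Lemma compE_op f g : src f = tgt g -> comp f g = g ** idm (oi (src f)) ** f.
Proof.
move=> fg; rewrite -mprod_morA -{2}[g]comp1m -fg.
rewrite -[idm (oi _) ** f]compm1 src_mul src_idm oil interchange; last first.
- by rewrite tgt_idm src_mul src_idm oil.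
- by rewrite src_idm.
by rewrite mprod_morx1 idmKV.
Qed.

(** The inverse of [f] for the monoidal product: by [compE], multiplying it by [f] amounts to
    composing [f] with [ci f]. *)
Definition star f := idm (oi (src f)) ** ci f ** idm (oi (tgt f)).

Lemma mul_star f : f ** star f = idm u.
Proof. by rewrite /star !mprod_morA -compE ?tgt_ci // cir idm_mul oir. Qed.

Lemma star_mul f : star f ** f = idm u.
Proof.
rewrite /star -!mprod_morA (mprod_morA (ci f)) -{1}(src_ci f).
by rewrite -compE ?src_ci // cil idm_mul oil.
Qed.

Lemma starK f g : star f ** (f ** g) = g.
Proof. by rewrite mprod_morA star_mul mprod_mor1x. Qed.

Lemma starKV f g : f ** (star f ** g) = g.
Proof. by rewrite mprod_morA mul_star mprod_mor1x. Qed.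

Lemma mul_injl f g g' : f ** g = f ** g' -> g = g'.
Proof. by move/(congr1 (fun h => star f ** h)); rewrite !starK. Qed.

Lemma mul_injr f g g' : g ** f = g' ** f -> g = g'.
Proof.
move/(congr1 (fun h => h ** star f)).
by rewrite -!mprod_morA mul_star !mprod_morx1.
Qed.

Lemma src_star f : src (star f) = oi (src f).
Proof. by rewrite !src_mul !src_idm src_ci -mprod_objA oir mprod_objx1. Qed.

Lemma tgt_star f : tgt (star f) = oi (tgt f).
Proof. by rewrite !tgt_mul !tgt_idm tgt_ci oil mprod_obj1x. Qed.

Lemma comp_ciK f g : src f = tgt g -> comp (comp f g) (ci g) = f.
Proof. by move=> fg; rewrite -compA ?tgt_ci // cir -fg compm1. Qed.

Lemma comp_ciKV f g : src f = src g -> comp (comp f (ci g)) g = f.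
Proof. by move=> fg; rewrite -compA ?src_ci ?tgt_ci // cil -fg compm1. Qed.

(** * Counting factorisations in a 2-group *)

Lemma N2_inj2 f p q : N2 f p -> N2 f q -> p.2 = q.2 -> p = q.
Proof.
case: p q => [a b] [c d] [/= ab <-] [/= cd fE] bd; subst d.
by rewrite -[c](comp_ciK cd) fE comp_ciK.
Qed.

Lemma N2_inj1 f p q : N2 f p -> N2 f q -> p.1 = q.1 -> p = q.
Proof.
case: p q => [a b] [c d] [/= ab <-] [/= cd fE] ac; subst c.
suff -> : b = d by [].
have K h : src a = tgt h -> comp (ci a) (comp a h) = h.
  by move=> ah; rewrite compA ?src_ci // cil ah comp1m.
by rewrite -(K b) // -(K d) // fE.
Qed.

Local Notation S := (mor_from_unit C).

Lemma mor_from_unitE f : S f <-> src f = u.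
Proof. by split=> [[x _ []]|fu] //; exists (tgt f). Qed.

(** A factorisation of [f] is determined by its second factor, which can be any morphism with the
    source of [f]; multiplying by an identity translates these to the morphisms with source [u]. *)
Lemma fsum_N2_const (W : zmodType) f (c : W) :
  \sum_(p \in N2 f) c = \sum_(s \in S) c.
Proof.
pose x := src f; symmetry.
apply: (fsum_can (fun=> c) (h := fun p => idm (oi x) ** p.2)
  (h' := fun s => (comp f (ci (idm x ** s)), idm x ** s))).
- by move=> p pN; apply/mor_from_unitE; rewrite src_mul src_idm (N2_src pN).
- move=> s /mor_from_unitE su; split=> /=; last first.
    by rewrite comp_ciKV // src_mul src_idm su mprod_objx1.
  by rewrite src_comp ?src_ci // tgt_ci src_mul src_idm su mprod_objx1.
- move=> [a b] [/= ab fE]; rewrite idmKV.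
  by rewrite -{1}fE comp_ciK.
- by move=> s _; rewrite idmK.
Qed.

(** Each [s] in [S] is the second factor of the factorisation [(ci s, s)] of [idm u]. *)
Lemma finite_mor_from_unit : finite_set S.
Proof.
apply: (@sub_finite_set _ _ ((fun p : C * C => p.2) @` N2 (idm u : C))).
  move=> s /mor_from_unitE su; exists (ci s, s) => //; split=> /=.
    by rewrite src_ci.
  by rewrite cil su.
exact/finite_image/Cfin.
Qed.

(** * Sums over factorisations with the scaling [lam] *)

Variable k : fieldType.
Hypothesis pchar0 : [pchar k] =i pred0.
Local Notation A := {malg k[C]}.
Local Notation A2 := {malg k[(C * C)%type]}.
Local Notation A3 := {malg k[(C * C * C)%type]}.
Local Notation lam := ((#|` fset_set S|)%fset%:R : k).
Local Notation mul := (inc_mul k C).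
Local Notation one := (inc_one k C).
Local Notation D := (inc_Delta k C lam).
Local Notation e := (inc_eps k C lam).

Lemma lam_neq0 : lam != 0.
Proof.
rewrite ((pcharf0P k).1 pchar0) cardfs_eq0; apply/fset0Pn; exists (idm u).
rewrite in_fset_set; last exact: finite_mor_from_unit.
by apply/mem_set/mor_from_unitE; rewrite src_idm.
Qed.

Lemma scaled_fsum_N2_const (W : lmodType k) f (c : W) :
  \sum_(p \in N2 f) c = lam *: c.
Proof.
rewrite fsum_N2_const fsbig_finite; last exact: finite_mor_from_unit.
by rewrite big_const_seq count_predT iter_addr_0 scaler_nat.
Qed.

(* The fibre of N2 f x N2 g -> N2 (f ** g) over any pair is in bijection with
   N2 f, since the first factor of its points is arbitrary and determines the
   second one. *)
Lemma fsum_N2_mul (W : lmodType k) f g (F : C * C -> W) :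
  \sum_(p \in N2 f) \sum_(q \in N2 g) F (p.1 ** q.1, p.2 ** q.2) =
  lam *: \sum_(p \in N2 (f ** g)) F p.
Proof.
(* Writing [lam] as a sum over [N2 f] reduces the claim to the inner sums, with the first pair
   [(a, b)] fixed. *)
rewrite -(scaled_fsum_N2_const f).
apply: eq_fsbigr => -[a b] /set_mem [/= ab fE].
symmetry; apply: (fsum_can (h := fun q => (a ** q.1, b ** q.2))
                           (h' := fun r => (star a ** r.1, star b ** r.2))).
- move=> [c d] [/= cd gE]; split=> /=; first by rewrite src_mul tgt_mul ab cd.
  by rewrite -interchange // fE gE.
- move=> [c d] [/= cd fgE].
  have eab : src (star a) = tgt (star b) by rewrite src_star tgt_star ab.
  split=> /=; first by rewrite src_mul tgt_mul eab cd.
  rewrite -interchange // fgE mprod_morA.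
  (* As [f] is the composite of [a] and [b], interchange turns this product into a composite of
     [star a ** a] and [star b ** b]. *)
  suff -> : comp (star a) (star b) ** f = idm u by rewrite mprod_mor1x.
  rewrite -fE interchange // !star_mul comp_Id ?src_idm ?tgt_idm //.
  exact: Id_idm.
- by move=> [c d] _; rewrite /= !starK.
- by move=> [c d] _; rewrite /= !starKV.
Qed.

Lemma fsum_N2_unique (W : lmodType k) (c : C * C -> C) p0 (F : C * C -> W) f :
    N2 f p0 -> Id C (c p0) -> (forall p, N2 f p -> Id C (c p) -> p = p0) ->
  \sum_(p \in N2 f) e << c p >> *: F p = lam *: F p0.
Proof.
move=> p0N p0I p0U; rewrite (fsbigD1 p0) //=.
rewrite inc_epsU mem_set // fsbig1 ?addr0 // => p [/= pN np].
by rewrite inc_epsU memNset ?scale0r // => /(p0U _ pN).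
Qed.

Lemma N2_unit_src p : N2 (idm u : C) p -> src p.2 = u.
Proof. by move/N2_src; rewrite src_idm. Qed.

Lemma N2_unit_tgt p : N2 (idm u : C) p -> tgt p.1 = u.
Proof. by move/N2_tgt; rewrite tgt_idm. Qed.

(** Since [p.2] has source [u], an identity of the form [p.2 ** g] must be that of [src g];
    cancelling [g] determines [p.2], and so [p]. *)
Lemma fsum_N2_snd_mul (W : lmodType k) g (F : C * C -> W) :
  \sum_(p \in N2 (idm u : C)) e << p.2 ** g >> *: F p =
  lam *: F (g ** idm (oi (tgt g)), ci g ** idm (oi (tgt g))).
Proof.
set p0 := (_, _); have p0N : N2 (idm u : C) p0.
  split; rewrite /= ?src_mul ?tgt_mul ?src_idm ?tgt_idm ?tgt_ci //.
  by rewrite -interchange ?tgt_ci ?src_idm ?tgt_idm // cir comp_Id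
    ?src_idm ?tgt_idm ?idm_mul ?oir //; exact: Id_idm.
have p0E : p0.2 ** g = idm (src g).
  by rewrite /p0 /= -{1}(src_ci g) -compE ?src_ci // cil.
apply: (fsum_N2_unique (c := fun p => p.2 ** g)) => //= [|p pN /Id_srcE pI].
  by rewrite p0E; exact: Id_idm.
apply: (N2_inj2 pN p0N); apply: (@mul_injr g).
by rewrite p0E pI src_mul N2_unit_src // mprod_obj1x.
Qed.

Lemma fsum_N2_mul_snd (W : lmodType k) f (F : C * C -> W) :
  \sum_(p \in N2 (idm u : C)) e << f ** p.2 >> *: F p =
  lam *: F (idm (oi (tgt f)) ** f, idm (oi (tgt f)) ** ci f).
Proof.
set p0 := (_, _); have p0N : N2 (idm u : C) p0.
  split; rewrite /= ?src_mul ?tgt_mul ?src_idm ?tgt_idm ?tgt_ci //.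
  by rewrite -interchange ?tgt_ci ?src_idm ?tgt_idm // cir comp_Id
    ?src_idm ?tgt_idm ?idm_mul ?oil //; exact: Id_idm.
have p0E : f ** p0.2 = idm (src f).
  by rewrite /p0 /= mprod_morA -{1}(src_ci f) -compE_op ?src_ci // cil.
apply: (fsum_N2_unique (c := fun p => f ** p.2)) => //= [|p pN /Id_srcE pI].
  by rewrite p0E; exact: Id_idm.
apply: (N2_inj2 pN p0N); apply: (@mul_injl f).
by rewrite p0E pI src_mul N2_unit_src // mprod_objx1.
Qed.

(** Here targets replace sources: [p.1] has target [u], so an identity [p.1 ** f] must be that of
    [tgt f]. *)
Lemma fsum_N2_fst_mul (W : lmodType k) f (F : C * C -> W) :
  \sum_(p \in N2 (idm u : C)) e << p.1 ** f >> *: F p =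
  lam *: F (ci f ** idm (oi (src f)), f ** idm (oi (src f))).
Proof.
set p0 := (_, _); have p0N : N2 (idm u : C) p0.
  split; rewrite /= ?src_mul ?tgt_mul ?src_idm ?tgt_idm ?src_ci //.
  by rewrite -interchange ?src_ci ?src_idm ?tgt_idm // cil comp_Id
    ?src_idm ?tgt_idm ?idm_mul ?oir //; exact: Id_idm.
have p0E : p0.1 ** f = idm (tgt f).
  by rewrite /p0 /= -compE_op ?tgt_ci // cir.
apply: (fsum_N2_unique (c := fun p => p.1 ** f)) => //= [|p pN /Id_tgtE pI].
  by rewrite p0E; exact: Id_idm.
apply: (N2_inj1 pN p0N); apply: (@mul_injr f).
by rewrite p0E pI tgt_mul N2_unit_tgt // mprod_obj1x.
Qed.

Lemma Id_idm_mul x f : Id C (idm x ** f) <-> Id C f.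
Proof.
split=> [[y _ fE]|[y _ <-]]; last by rewrite idm_mul; exact: Id_idm.
by rewrite -(idmK x f) -fE idm_mul; exact: Id_idm.
Qed.

Lemma Id_mul_idm x f : Id C (f ** idm x) <-> Id C f.
Proof.
split=> [[y _ fE]|[y _ <-]]; last by rewrite idm_mul; exact: Id_idm.
rewrite -[f]mprod_morx1 -(oir x) -idm_mul mprod_morA -fE idm_mul.
exact: Id_idm.
Qed.

Lemma inc_eps_Id f g : (Id C f <-> Id C g) -> e << f >> = e << g >>.
Proof.
move=> fg; rewrite !inc_epsU; congr (if _ then _ else _).
by apply/idP/idP => /set_mem/fg/mem_set.
Qed.

(** A morphism from [oi (tgt f)] to [oi (src f)], whereas [star f] goes the other way. *)
Definition antipode f := idm (oi (tgt f)) ** f ** idm (oi (src f)).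

(** By [compE], the last three factors form the composite [f]. The result is the same for all [p],
    so the sums in the antipode axioms are constant. *)
Lemma antipode_mul f p : N2 f p -> antipode p.1 ** p.2 = idm (oi (tgt f)) ** f.
Proof.
case: p => [a b] [/= ab <-].
by rewrite tgt_comp // compE // /antipode !mprod_morA.
Qed.

Lemma mul_antipode f p : N2 f p -> p.1 ** antipode p.2 = f ** idm (oi (src f)).
Proof.
case: p => [a b] [/= ab <-].
by rewrite src_comp // compE // /antipode ab !mprod_morA.
Qed.

(** * The axioms of a weak Hopf algebra *)

Let mulL := @inc_mul_linearl k C.
Let mulR := @inc_mul_linearr k C.
Let eL : scalar e := @inc_eps_linear k C lam.
Let DL := @inc_Delta_linear k C lam.

(** On morphisms a single factorisation of [idm u] contributes; its factor [lam] cancels the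
    scaling, and what remains is [f ** g] times an identity, which has the same counit. *)
Lemma inc_eps_mul12 (a b : A) : e (mul a b) =
  tlift (W := k^o) (fun x y => e (mul a x) * e (mul y b)) (D one).
Proof.
move: a b; apply: (@lext_ext2 k C C k^o (fun a b => e (mul a b))
  (fun a b => tlift (W := k^o) (fun x y => e (mul a x) * e (mul y b)) (D one))).
- by move=> b c a a'; rewrite mulL eL.
- by move=> a c b b'; rewrite mulR eL.
- move=> b; apply: (tlift_linear_fun (U := A) (V := k^o)
    (F := fun a x y => e (mul a x) * e (mul y b))) => x y c a a'.
  by rewrite mulL eL mulrDl -mulrA.
- move=> a; apply: (tlift_linear_fun (U := A) (V := k^o)
    (F := fun b x y => e (mul a x) * e (mul y b))) => x y c b b'.
  by rewrite mulR eL mulrDr mulrCA.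
move=> f g; rewrite (tlift_Delta _ Cfin).
under eq_fsbigr do rewrite !inc_mulU mulrC.
rewrite (fsum_N2_snd_mul (W := k^o) g (fun p => e << f ** p.1 >>)).
rewrite scalerA mulVf ?lam_neq0 // scale1r inc_mulU /= mprod_morA.
by apply: inc_eps_Id; rewrite Id_mul_idm.
Qed.

Lemma inc_eps_mul21 (a b : A) : e (mul a b) =
  tlift (W := k^o) (fun x y => e (mul a y) * e (mul x b)) (D one).
Proof.
move: a b; apply: (@lext_ext2 k C C k^o (fun a b => e (mul a b))
  (fun a b => tlift (W := k^o) (fun x y => e (mul a y) * e (mul x b)) (D one))).
- by move=> b c a a'; rewrite mulL eL.
- by move=> a c b b'; rewrite mulR eL.
- move=> b; apply: (tlift_linear_fun (U := A) (V := k^o)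
    (F := fun a x y => e (mul a y) * e (mul x b))) => x y c a a'.
  by rewrite mulL eL mulrDl -mulrA.
- move=> a; apply: (tlift_linear_fun (U := A) (V := k^o)
    (F := fun b x y => e (mul a y) * e (mul x b))) => x y c b b'.
  by rewrite mulR eL mulrDr mulrCA.
move=> f g; rewrite (tlift_Delta _ Cfin).
under eq_fsbigr do rewrite !inc_mulU.
rewrite (fsum_N2_mul_snd (W := k^o) f (fun p => e << p.1 ** g >>)).
rewrite scalerA mulVf ?lam_neq0 // scale1r inc_mulU /= -mprod_morA.
by apply: inc_eps_Id; rewrite Id_idm_mul.
Qed.

Lemma tensor_Delta_one : tensor (D one) one =
  lam^-1 *: \sum_(p \in N2 (idm u : C)) (<< (p.1, p.2, idm u) >> : A3).
Proof.
rewrite /tensor lext_Delta; last exact: Cfin.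
congr (_ *: _); apply: eq_fsbigr => p _.
by rewrite lextU -surjective_pairing.
Qed.

Lemma tensor_one_Delta : tassoc (tensor one (D one)) =
  lam^-1 *: \sum_(p \in N2 (idm u : C)) (<< (idm u, p.1, p.2) >> : A3).
Proof.
have tassocL : linear (@tassoc k C C C) by exact: tlift_linear.
rewrite {2}/inc_one /inc_Delta lextU (linearZ_fun _ _ (tensor_linearr _)).
rewrite (linear_fsum_fun _ (tensor_linearr _)); last exact: Cfin.
rewrite (linearZ_fun _ _ tassocL) (linear_fsum_fun _ tassocL); last exact: Cfin.
congr (_ *: _); apply: eq_fsbigr => p _.
by rewrite /inc_one tensorU /tassoc /tlift !lextU !tensorU.
Qed.

Lemma tmul_sum (I J : choiceType) (P : set I) (Q : set J)
    (F : I -> C * C * C) (G : J -> C * C * C) (c d : k) :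
    finite_set P -> finite_set Q ->
  tmul (tmul mul mul) mul (c *: \sum_(i \in P) (<< F i >> : A3))
                          (d *: \sum_(j \in Q) (<< G j >> : A3)) =
  (c * d) *: \sum_(i \in P) \sum_(j \in Q)
    (<< ((F i).1.1 ** (G j).1.1, (F i).1.2 ** (G j).1.2, (F i).2 ** (G j).2) >>
     : A3).
Proof.
move=> Pfin Qfin; have L := tmul_linearl (tmul mul mul) mul.
have R := tmul_linearr (tmul mul mul) mul.
rewrite (linearZ_fun _ _ (L _)) (linear_fsum_fun _ (L _)); last exact: Pfin.
rewrite -scalerA; congr (_ *: _).
rewrite [RHS]scaler_fsumr; last exact: Pfin.
apply: eq_fsbigr => i _.
rewrite (linearZ_fun _ _ (R _)) (linear_fsum_fun _ (R _)); last exact: Qfin.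
congr (_ *: _); apply: eq_fsbigr => j _.
by rewrite tmulU tmulU !inc_mulU !tensorU.
Qed.

(** These are the middle entries in the two products of [tensor (D one) one] and
    [tassoc (tensor one (D one))], identified by the Eckmann-Hilton argument. *)
Lemma N2_unit_comp p q : N2 (idm u : C) p -> N2 (idm u : C) q ->
  p.2 ** q.1 = comp p.2 q.1 /\ q.1 ** p.2 = comp p.2 q.1.
Proof.
move=> /N2_unit_src pu /N2_unit_tgt qu; split; first exact: mul_comp.
exact: mul_comp_op.
Qed.

(** With the last factor [q.2] fixed, the factorisations of [q.1] are those of [idm u] with the
    second factor composed with the invertible [q.1]. *)
Lemma Delta2_one : Delta2 D one = (lam^-1 * lam^-1) *:
  \sum_(p \in N2 (idm u : C)) \sum_(q \in N2 (idm u : C))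
     (<< (p.1, comp p.2 q.1, q.2) >> : A3).
Proof.
rewrite /inc_one (Delta2U _ Cfin); congr (_ *: _).
rewrite [RHS](exchange_fsbig _ _ (Cfin (idm u)) (Cfin (idm u))).
apply: eq_fsbigr => q /set_mem qN; have qu := N2_unit_tgt qN.
apply: (fsum_can (fun r => << (r.1, r.2, q.2) >> : A3)
  (h := fun p => (p.1, comp p.2 q.1))
  (h' := fun r => (r.1, comp r.2 (ci q.1)))).
- move=> [a b] abN; have bu := N2_unit_src abN; case: abN => /= ab abE.
  have bq : src b = tgt q.1 by rewrite bu qu.
  split=> /=; first by rewrite tgt_comp.
  by rewrite compA // abE -qu comp1m.
- move=> [a b] abN; have bq := N2_src abN; case: abN => /= ab abE.
  split=> /=; first by rewrite tgt_comp // tgt_ci.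
  by rewrite compA ?tgt_ci // abE cir qu.
- move=> [a b] abN; have /= bu := N2_unit_src abN.
  by rewrite /= comp_ciK // bu qu.
- move=> [a b] abN; have /= bq := N2_src abN.
  by rewrite /= comp_ciKV.
Qed.

Lemma inc_weak_Hopf : exists sigma, is_weak_Hopf mul one D e sigma.
Proof.
have lam0 := lam_neq0.
pose sigma : A -> A := lext (fun f => << antipode f >>).
have sigmaL : linear sigma by exact: lext_linear.
have sigmaU f : sigma << f >> = << antipode f >> by rewrite /sigma lextU.
exists sigma; split.
- exact: inc_algebra.
- exact: inc_coalgebra.
- by apply: inc_DeltaM => // f g F; exact: fsum_N2_mul.
- exact: inc_eps_mul12.
- exact: inc_eps_mul21.
- rewrite tensor_Delta_one tensor_one_Delta.
  rewrite (tmul_sum _ _ _ _ (Cfin _) (Cfin _)) /= Delta2_one.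
  congr (_ *: _); apply: eq_fsbigr => p /set_mem pN.
  apply: eq_fsbigr => q /set_mem qN.
  by rewrite mprod_morx1 mprod_mor1x (N2_unit_comp pN qN).1.
- rewrite tensor_Delta_one tensor_one_Delta.
  rewrite (tmul_sum _ _ _ _ (Cfin _) (Cfin _)) /= Delta2_one.
  congr (_ *: _).
  rewrite [LHS](exchange_fsbig _ _ (Cfin (idm u)) (Cfin (idm u))).
  apply: eq_fsbigr => p /set_mem pN.
  apply: eq_fsbigr => q /set_mem qN.
  by rewrite mprod_morx1 mprod_mor1x (N2_unit_comp pN qN).2.
- exact: sigmaL.
- pose G (t : A2) (c : A) : A :=
    tlift (fun a1 a2 => mul (mul (sigma a1) a2) (sigma c)) t.
  apply: (lext_ext (g := fun a => tlift G (Delta2 D a))) => // [|f].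
    apply: linear_comp; first exact: tlift_linear.
    by apply: linear_comp DL; exact: tlift_linear.
  rewrite (Delta2U _ Cfin) (linearZ_fun _ _ (tlift_linear G)).
  rewrite (linear_fsum_fun _ (tlift_linear G) (Cfin _)).
  (* Every factorisation of [f] into three contributes [antipode f]; the inner and the outer sum
     each yield a factor [lam], cancelling the two inverses in [Delta2U]. *)
  have inner p : N2 f p -> tlift G
      (\sum_(q \in N2 p.1) (<< (q.1, q.2, p.2) >> : A3)) =
      lam *: << antipode f >>.
    move=> pN; rewrite (linear_fsum_fun _ (tlift_linear G) (Cfin _)).
    rewrite -(scaled_fsum_N2_const p.1); apply: eq_fsbigr => q /set_mem qN.
    rewrite /tlift lextU /G /tlift lextU !sigmaU !inc_mulU (antipode_mul qN).
    rewrite (N2_tgt pN) -mprod_morA (mul_antipode pN).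
    by rewrite /antipode mprod_morA.
  rewrite (eq_fsbigr (fun=> lam *: << antipode f >>)); last first.
    by move=> p /set_mem; exact: inner.
  by rewrite scaled_fsum_N2_const !scalerA sigmaU mulfVK // mulVf // scale1r.
- apply: lext_ext => [||f].
  + by apply: linear_comp DL; exact: tlift_linear.
  + apply: (tlift_linear_fun (F := fun a x y => e (mul a y) *: x)) => x y.
    by apply: linear_scalel => c a a'; rewrite mulL eL.
  rewrite !(tlift_Delta _ Cfin); congr (_ *: _).
  (* On the left there are [lam] equal terms, on the right a single term with coefficient [lam]. *)
  transitivity (\sum_(p \in N2 f) (<< idm (oi (tgt f)) ** f >> : A)).
    apply: eq_fsbigr => p /set_mem pN.
    by rewrite sigmaU inc_mulU (antipode_mul pN).
  under [RHS]eq_fsbigr do rewrite inc_mulU.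
  by rewrite scaled_fsum_N2_const (fsum_N2_mul_snd f (fun p => << p.1 >> : A)).
- apply: lext_ext => [||f].
  + by apply: linear_comp DL; exact: tlift_linear.
  + apply: (tlift_linear_fun (F := fun a x y => e (mul x a) *: y)) => x y.
    by apply: linear_scalel => c a a'; rewrite mulR eL.
  rewrite !(tlift_Delta _ Cfin); congr (_ *: _).
  transitivity (\sum_(p \in N2 f) (<< f ** idm (oi (src f)) >> : A)).
    apply: eq_fsbigr => p /set_mem pN.
    by rewrite sigmaU inc_mulU (mul_antipode pN).
  under [RHS]eq_fsbigr do rewrite inc_mulU.
  by rewrite scaled_fsum_N2_const (fsum_N2_fst_mul f (fun p => << p.2 >> : A)).
Qed.

End TwoGroup.

Theorem theorem1 (k : fieldType) :
  (forall C : monoidal_cat, moebius C -> ULF (mprod C) ->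
    [/\ is_bialgebra (inc_mul k C) (inc_one k C) (inc_Delta k C 1)
          (inc_eps k C 1),
        is_pointed (inc_Delta k C 1) &
        obj_group C ->
        exists sigma : {malg k[C]} -> {malg k[C]},
          is_Hopf (inc_mul k C) (inc_one k C) (inc_Delta k C 1)
            (inc_eps k C 1) sigma]) /\
  ([pchar k] =i pred0 ->
   forall C : monoidal_cat, strict_2group C -> locally_finite C ->
    finite_set (mor_from_unit C) /\
    let lambda : k := (#|` fset_set (mor_from_unit C)|)%fset%:R in
    exists sigma : {malg k[C]} -> {malg k[C]},
      is_weak_Hopf (inc_mul k C) (inc_one k C) (inc_Delta k C lambda)
        (inc_eps k C lambda) sigma).
Proof.
split=> [C Cmoeb Culf|pchar0 C [/choice[ci ciP] /choice[oi oiP]] Cfin].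
  by split; [exact: inc_bialgebra|exact: inc_pointed|exact: inc_Hopf].
split; first exact: (finite_mor_from_unit ciP Cfin).
exact: (inc_weak_Hopf oiP ciP Cfin pchar0).
Qed.
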